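(* For any $c\in(1,\infty)$, $\delta\in(0,1)$, $\beta\in(0,1)$ and $\lambda\in(0,2)$ there exists a constant $C_{c,\delta,\beta,\lambda}>0$, depending only on $c,\delta,\beta,\lambda$ (and in particular independent of $N$, $\alpha$ and the weights), such that the following holds. Let $\alpha>1/2$ satisfy $1/\alpha<\lambda$, let $d\in\mathbb{N}$, let $\boldsymbol{\gamma}=(\gamma_u)_{u\subset\mathbb{N},|u|<\infty}$ be a collection of non-negative weights with $\gamma_\emptyset=1$, let $M\ge1$, and let $\mathcal{A}_d=\mathcal{A}_{d,\alpha,\boldsymbol{\gamma}}(M)=\{\boldsymbol{k}\in\mathbb{Z}^d \mid r_{\alpha,\boldsymbol{\gamma}}(\boldsymbol{k})\le M\}$. Assume $|\mathcal{A}_d|\ge 2$ and $\eta:=c(|\mathcal{A}_d|-1)\ge \max(N_{\mathcal{A}_d},\,4L_{\max}\log L_{\max})$. Consider the deterministic multiple rank-1 lattice-based algorithm $A_N^{\mathrm{mult}}$ in which the number of lattices $L$ and the lattice parameters $(n_t,\boldsymbol{g}_t)$, $t=1,\ldots,L$, are the output of the random construction (Algorithm LC, described in the context) with input $\mathcal{A}_d,c,\delta$, and $N=\sum_{t=1}^L n_t$. Then, with probability at least $1-\delta$ (with respect to the random construction of the lattices), $$\mathrm{err}_\infty(A_N^{\mathrm{mult}},H_{d,\alpha,\boldsymbol{\gamma}})\le\frac{C_{c,\delta,\beta,\lambda}}{N^{1/(\lambda(1+\beta))-1/2}}\left(\sum_{u\subseteq\{1,\ldots,d\}}\gamma_u^\lambda(2\zeta(\alpha\lambda))^{|u|}\right)^{1/\lambda},$$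 where $\zeta$ is the Riemann zeta function. In particular, as $\lambda\to1/\alpha$ and $\beta\to0$, the exponent $1/(\lambda(1+\beta))-1/2$ tends to $\alpha-1/2$, i.e. the convergence rate gets arbitrarily close to $\mathcal{O}(N^{-\alpha+1/2})$.
   Context: **Weighted Korobov space.** For $\boldsymbol{k}\in\mathbb{Z}^d$ let $u=\mathrm{supp}(\boldsymbol{k})=\{j\in\{1,\ldots,d\}\mid k_j\ne0\}$ and $r_{\alpha,\boldsymbol{\gamma}}(\boldsymbol{k})=\frac{1}{\gamma_u}\prod_{j\in u}|k_j|^\alpha$ (empty product $=1$; if $\gamma_u=0$, then $r_{\alpha,\boldsymbol{\gamma}}(\boldsymbol{k})=+\infty$ and $\widehat f(\boldsymbol{k})=0$ is required). $H_{d,\alpha,\boldsymbol{\gamma}}$ is the space of continuous functions $f$ on $[0,1]^d$, 1-periodic in each variable, with finite norm $\|f\|_{d,\alpha,\boldsymbol{\gamma}}=\big(\sum_{\boldsymbol{k}\in\mathbb{Z}^d}r_{\alpha,\boldsymbol{\gamma}}^2(\boldsymbol{k})|\widehat f(\boldsymbol{k})|^2\big)^{1/2}$, where $\widehat f(\boldsymbol{k})=\int_{[0,1]^d}f(\boldsymbol{x})e^{-2\pi i\boldsymbol{k}\cdot\boldsymbol{x}}\,\mathrm{d}\boldsymbol{x}$ (terms with $\gamma_u=0$ are omitted). **Rank-1 lattices.** For $n\in\mathbb{N}$ and an integer vector $\boldsymbol{g}=(g_1,\ldots,g_d)$, $P_{n,\boldsymbol{g}}=\{(\{ig_1/n\},\ldots,\{ig_d/n\})\mid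 0\le i<n\}$, where $\{\cdot\}$ is the fractional part. **Aliasing-free frequencies.** A frequency $\boldsymbol{k}\in\mathcal{A}_d$ is aliasing-free for $(n,\boldsymbol{g})$ if no $\boldsymbol{m}\in\mathcal{A}_d\setminus\{\boldsymbol{k}\}$ satisfies $\boldsymbol{m}\cdot\boldsymbol{g}\equiv\boldsymbol{k}\cdot\boldsymbol{g}\pmod n$. For lattices $(n_t,\boldsymbol{g}_t)$, $t=1,\ldots,L$, put $U_t(\boldsymbol{k})=1$ if $\boldsymbol{k}$ is aliasing-free for $(n_t,\boldsymbol{g}_t)$ and $U_t(\boldsymbol{k})=0$ otherwise, and $\xi(\boldsymbol{k})=\sum_{t=1}^LU_t(\boldsymbol{k})$. **Algorithm LC.** Input: $\mathcal{A}_d$, $c\in(1,\infty)$, $\delta\in(0,1)$. Set $L_{\max}=\left\lceil\left(\frac{c}{c-1}\right)^2\frac{\log|\mathcal{A}_d|-\log\delta}{2}\right\rceil$ and $\eta=c(|\mathcal{A}_d|-1)$. Let $\mathcal{P}_{\mathcal{A}_d}$ be the set of primes $n$ such that the vectors $\boldsymbol{k}\bmod n$ (componentwise), $\boldsymbol{k}\in\mathcal{A}_d$, are pairwise distinct, and let $p_1<\cdots<p_{L_{\max}}$ be the $L_{\max}$ smallest elements of $\mathcal{P}_{\mathcal{A}_d}$ greater than $\eta$. Start with $t=0$, $\mathcal{B}_d=\varnothing$. While $|\mathcal{B}_d|<|\mathcal{A}_d|$ and $t<L_{\max}$: replace $t$ by $t+1$; set $n_t=p_t$; draw $\boldsymbol{g}_t$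 uniformly at random from $\{1,\ldots,n_t\}^d$ (independently of all previous draws); let $\mathcal{A}_{d,t}$ be the set of $\boldsymbol{k}\in\mathcal{A}_d$ aliasing-free for $(n_t,\boldsymbol{g}_t)$; if $\mathcal{A}_{d,t}\not\subseteq\mathcal{B}_d$, replace $\mathcal{B}_d$ by $\mathcal{B}_d\cup\mathcal{A}_{d,t}$, otherwise replace $t$ by $t-1$ (discarding the draw). Output: $(n_1,\boldsymbol{g}_1),\ldots,(n_L,\boldsymbol{g}_L)$ with $L=t$. The total number of points is $N=\sum_{t=1}^Ln_t$. Also $N_{\mathcal{A}_d}=\max_{1\le j\le d}\big(\max_{\boldsymbol{k}\in\mathcal{A}_d}k_j-\min_{\boldsymbol{h}\in\mathcal{A}_d}h_j\big)$. **Approximation algorithm.** Writing $P_{n_t,\boldsymbol{g}_t}=\{\boldsymbol{y}^{(t)}_0,\ldots,\boldsymbol{y}^{(t)}_{n_t-1}\}$, $A_N^{\mathrm{mult}}(f)(\boldsymbol{x})=\sum_{\boldsymbol{k}\in\mathcal{A}_d}\widehat f_N^{\mathrm{mult}}(\boldsymbol{k})e^{2\pi i\boldsymbol{k}\cdot\boldsymbol{x}}$ with $\widehat f_N^{\mathrm{mult}}(\boldsymbol{k})=\frac1{\xi(\boldsymbol{k})}\sum_{t=1}^L\frac{U_t(\boldsymbol{k})}{n_t}\sum_{i=0}^{n_t-1}f(\boldsymbol{y}_i^{(t)})e^{-2\pi i\boldsymbol{k}\cdot\boldsymbol{y}_i^{(t)}}$. It is well defined when $\xi(\boldsymbol{k})\ge1$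 for all $\boldsymbol{k}\in\mathcal{A}_d$; ''with probability at least $1-\delta$'' means that the event that the algorithm is well defined and the stated bound holds has probability at least $1-\delta$. **Error.** $\mathrm{err}_\infty(A_N^{\mathrm{mult}},H_{d,\alpha,\boldsymbol{\gamma}})=\sup_{\|f\|_{d,\alpha,\boldsymbol{\gamma}}\le1}\ \sup_{\boldsymbol{x}\in[0,1]^d}|f(\boldsymbol{x})-A_N^{\mathrm{mult}}(f)(\boldsymbol{x})|$. *)

(* Defs.v *)
From HB Require Import structures.
From mathcomp Require Import all_boot all_order all_algebra finmap.
From mathcomp Require Import complex.
From mathcomp Require Import all_classical all_reals all_analysis.
Set Implicit Arguments.
Unset Strict Implicit.
Unset Printing Implicit Defensive.
Import Order.TTheory GRing.Theory Num.Theory.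
Import numFieldNormedType.Exports.
Local Open Scope classical_set_scope.
Local Open Scope ring_scope.

Section KorobovSpace.
Variables (R : realType) (d : nat).

Definition cis (t : R) : R[i] := Complex (cos t) (sin t).

Definition phase (k : 'rV[int]_d) (x : 'rV[R]_d) : R :=
  2 * pi * \sum_(j < d) (k 0 j)%:~R * x 0 j.

Definition unit_cube : set 'rV[R]_d := [set x | forall j, 0 <= x 0 j <= 1].

(* Subsets of {1, ..., d} as finite sets of naturals; coordinate j : 'I_d of a
   vector carries the label j.+1. *)
Definition labels (u : {set 'I_d}) : {fset nat} :=
  [fset (nat_of_ord j).+1 | j in u]%fset.

Definition supp (k : 'rV[int]_d) : {set 'I_d} := [set j | k 0 j != 0]%SET.

Definition korobov_r (alpha : R) (gamma : {fset nat} -> R) (k : 'rV[int]_d)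
    : \bar R :=
  if gamma (labels (supp k)) == 0 then +oo%E
  else ((gamma (labels (supp k)))^-1 *
        \prod_(j in supp k) (`|k 0 j|%:~R `^ alpha))%:E.

End KorobovSpace.

(* Integral over [0,1]^d as d iterated one-dimensional Lebesgue integrals; it
   is only applied to continuous integrands. *)
Fixpoint cube_integral (R : realType) (d : nat) : ('rV[R]_d -> R) -> R :=
  match d with
  | 0 => fun F => F 0
  | e.+1 => fun F =>
      \int[@lebesgue_measure R]_(t in `[0, 1])
        cube_integral (fun x : 'rV[R]_e => F (row_mx (t%:M : 'rV[R]_1) x))
  end.

Section KorobovNorm.
Variables (R : realType) (d : nat).
Implicit Types (f : 'rV[R]_d -> R[i]) (k : 'rV[int]_d).

Definition fourier_coef f k : R[i] :=
  Complex
    (cube_integral (fun x => complex.Re (f x * cis (- phase k x))))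
    (cube_integral (fun x => complex.Im (f x * cis (- phase k x)))).

Variables (alpha : R) (gamma : {fset nat} -> R).

Definition korobov_norm f : \bar R :=
  ((\esum_(k in [set k | gamma (labels (supp k)) != 0%R])
     (korobov_r alpha gamma k ^+ 2 * ((ComplexField.Normc.normc (fourier_coef f k)) ^+ 2)%:E))
   `^ 2^-1)%E.

(* A continuous 1-periodic function on [0,1]^d is represented by its periodic
   extension to R^d. *)
Definition korobov_space f : Prop :=
  [/\ continuous (fun x => complex.Re (f x)) /\
      continuous (fun x => complex.Im (f x)),
      forall x j, f (x + delta_mx 0 j) = f x,
      forall k, gamma (labels (supp k)) = 0 -> fourier_coef f k = 0 &
      (korobov_norm f < +oo)%E].

Definition korobov_set (M : R) : set 'rV[int]_d :=
  [set k | (korobov_r alpha gamma k <= M%:E)%E].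

Definition err_infty (A : ('rV[R]_d -> R[i]) -> 'rV[R]_d -> R[i]) : \bar R :=
  ereal_sup
    [set ereal_sup [set (ComplexField.Normc.normc (f x - A f x))%:E | x in @unit_cube R d]
    | f in [set f | korobov_space f /\ (korobov_norm f <= 1)%E]].

End KorobovNorm.

Definition zeta (R : realType) (s : R) : R :=
  limn (series (fun n : nat => n.+1%:R `^ (- s))).

Section Lattices.
Variables (d : nat) (A : {fset 'rV[int]_d}).

(* A rank-1 lattice is given by its size n and its generating vector g. *)
Definition lattice : Type := (nat * 'rV[int]_d)%type.
Implicit Types (l : lattice) (ls : seq lattice) (k g : 'rV[int]_d).

Definition dot k g : int := \sum_(j < d) k 0 j * g 0 j.

Definition aliasing_free l k : bool :=
  (k \in A) &&
  ~~ has (fun m => (m != k) && (dot m l.2 == dot k l.2 %[mod l.1])%Z) A.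

Definition xi ls k : nat := \sum_(l <- ls) aliasing_free l k.

Definition total_points ls : nat := \sum_(l <- ls) l.1.

Variable R : realType.

Definition lattice_point l (i : nat) : 'rV[R]_d :=
  \row_j (let y : R := i%:R * (l.2 0 j)%:~R / l.1%:R in
          y - (Num.floor y)%:~R).

Definition lattice_coef ls (f : 'rV[R]_d -> R[i]) k : R[i] :=
  (xi ls k)%:R^-1 *
  \sum_(l <- ls) (aliasing_free l k)%:R / l.1%:R *
    \sum_(i < l.1) f (lattice_point l i) * cis (- phase k (lattice_point l i)).

Definition A_mult ls (f : 'rV[R]_d -> R[i]) (x : 'rV[R]_d) : R[i] :=
  \sum_(k <- A) lattice_coef ls f k * cis (phase k x).

End Lattices.

Section AlgorithmLC.
Variables (R : realType) (d : nat) (A : {fset 'rV[int]_d}) (c delta : R).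

Definition Lmax : nat :=
  `|Num.ceil ((c / (c - 1)) ^+ 2 * ((ln #|` A|%:R - ln delta) / 2))|%N.

Definition lc_eta : R := c * (#|` A|%:R - 1).

Definition sep_primes : set nat :=
  [set n | prime n /\
     {in A &, injective (fun k => map_mx (fun z => (z %% n)%Z) k)}].

(* The t-th smallest element (t >= 1) of sep_primes above lc_eta. *)
Definition lc_prime (t : nat) : nat :=
  xget 0%N [set n : nat | [/\ sep_primes n, lc_eta < n%:R &
    ([set m | [/\ sep_primes m, lc_eta < m%:R & (m <= n)%N]] #= `I_t)%card]].

(* State of the loop: accepted lattices in order (their number is t), and the
   set B of covered frequencies. *)
Definition lc_state : Type := (seq (lattice d) * {fset 'rV[int]_d})%type.

Definition lc_init : lc_state := ([::], fset0).

Definition lc_running (s : lc_state) : bool :=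
  (#|` s.2| < #|` A|)%N && (size s.1 < Lmax)%N.

Definition lc_next_size (s : lc_state) : nat := lc_prime (size s.1).+1.

(* Once the loop condition fails, further draws are ignored. *)
Definition lc_step (s : lc_state) (g : 'rV[int]_d) : lc_state :=
  if lc_running s then
    let l := (lc_next_size s, g) in
    let At := [fset k in A | aliasing_free A l k]%fset in
    if (At `<=` s.2)%fset then s else (rcons s.1 l, (s.2 `|` At)%fset)
  else s.

Definition lc_run (h : seq 'rV[int]_d) : lc_state := foldl lc_step lc_init h.

Variables (disp : measure_display) (Omega : measurableType disp).
Variable P : probability Omega R.

(* g m is the (m+1)-st vector drawn, discarded draws included. As long as the
   loop runs, its conditional law given the preceding draws is uniform on
   {1, ..., n}^d, where n is the size determined by those draws. *)
Definition lc_draws (g : nat -> Omega -> 'rV[int]_d) : Prop :=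
  (forall m v, measurable (g m @^-1` [set v])) /\
  forall (h : seq 'rV[int]_d) (v : 'rV[int]_d),
    let n := lc_next_size (lc_run h) in
    lc_running (lc_run h) ->
    (forall j, 1 <= v 0 j <= n%:Z) ->
    P [set w | mkseq (g^~ w) (size h).+1 = rcons h v] =
    (P [set w | mkseq (g^~ w) (size h) = h] * ((n ^ d)%N%:R^-1)%:E)%E.

Definition lc_output (g : nat -> Omega -> 'rV[int]_d) (w : Omega)
    (ls : seq (lattice d)) : Prop :=
  exists m, let s := lc_run (mkseq (g^~ w) m) in
    ~~ lc_running s /\ ls = s.1.

End AlgorithmLC.

Section Spread.
Variables (d : nat) (A : {fset 'rV[int]_d}).

Definition coord_max (j : 'I_d) : int :=
  \big[Num.max/(head 0 (enum_fset A)) 0 j]_(k <- A) k 0 j.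

Definition coord_min (j : 'I_d) : int :=
  \big[Num.min/(head 0 (enum_fset A)) 0 j]_(k <- A) k 0 j.

Definition spread : int :=
  \big[Num.max/0]_(j < d) (coord_max j - coord_min j).

End Spread.

(* Main.v *)
(* For f in the Korobov ball and a point x, the error f(x) - A(f)(x) is a finite
   combination T f of point evaluations of f.  The Fejer means of f converge to f
   pointwise and are trigonometric polynomials whose coefficients are those of f
   damped by factors in [0, 1], so |T f| is at most the supremum of
   sum_k |fhat(k)| |T e_k| over finite sets of frequencies.  When every frequency
   of A is aliasing-free for some lattice, T e_k vanishes for k in A; otherwise
   |T e_k| <= 1 + L, because a residue class contains at most one aliasing-free
   frequency of A.  Cauchy-Schwarz reduces the error to (1 + L) times the l2-tail
   of 1/r outside A, and the estimates sum r^-lambda <= S, |A| <= M^lambda S and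
   r > M outside A turn this into (1 + L) |A|^-(1/lambda - 1/2) S^(1/lambda).
   Chebyshev's bound, read off the central binomial coefficient, gives
   p_L <= C |A|^(1 + beta/2); since L grows logarithmically, N <= C |A|^(1 + beta).
   For Algorithm LC, a frequency k in A is aliased for a uniform generating vector
   with probability at most q = 1/c.  An uncovered k that is not aliased forces the
   draw to be accepted, which makes q^(L_max - t) a supermartingale as long as k is
   uncovered; a union bound then leaves a failure probability of at most
   |A| q^L_max <= delta. *)
Require Import Defs.
From HB Require Import structures.
From mathcomp Require Import all_boot all_order all_algebra finmap.
From mathcomp Require Import complex.
From mathcomp Require Import all_classical all_reals all_analysis.
From mathcomp Require Import zify ring lra.
Set Implicit Arguments.
Unset Strict Implicit.
Unset Printing Implicit Defensive.
Import Order.TTheory GRing.Theory Num.Theory.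
Import numFieldNormedType.Exports.
Local Open Scope classical_set_scope.
Local Open Scope ring_scope.
Local Notation normc := ComplexField.Normc.normc.

(** * Chebyshev's lower bound for the number of primes *)

Section Chebyshev.
Local Open Scope nat_scope.

(** The obstacle in the probabilistic half is that the accepted lattices are not independent: a draw
    is kept only if it covers something new, the loop may end early, and a priori it may never end.
    Concentration for independent indicators does not apply as such. The estimate is therefore made
    over all draws, discarded ones included, by giving each state of the loop a potential that does
    not increase on average; one summand accounts for exhausting the [Lmax] lattices, the other for
    not having stopped yet. On the analytic side the error at a point only samples f, so it suffices
    to control it on characters. For the Fejer means, positivity of the kernel, its total mass and
    its Fourier coefficients at the unit vectors are enough. Of the exponent 1 + [beta] in the bound
    on N, one half of [beta] pays for the logarithm in the size of the primes and the other half for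
    the number of lattices. *)

Definition nprimes (n : nat) : nat := count prime (iota 1 n).

(** By Pascal's rule and symmetry, C(2m+2, m+1) = 2 C(2m+1, m), which is at least 2 C(2m, m). *)
Lemma expn2_le_central_bin m : 2 ^ m <= 'C(m.*2, m).
Proof.
elim: m => // m IH; rewrite expnS doubleS binS.
have -> : 'C(m.*2.+1, m.+1) = 'C(m.*2.+1, m).
  by rewrite -bin_sub -?addnn; [congr 'C(_, _); lia | lia].
rewrite mulSn mul1n -addnn; have -> : (m + m).+1 = m.*2.+1 by rewrite addnn.
by case: m IH => [|m] IH; rewrite ?bin0//; rewrite binS; lia.
Qed.

(** Legendre's formula writes the exponent as the sum over k of floor(2m / p^k) - 2 floor(m / p^k).
    Each term is 0 or 1, and it is 0 as soon as p^k > 2m. *)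
Lemma logn_central_bin p m : prime p -> logn p 'C(m.*2, m) <= trunc_log p m.*2.
Proof.
move=> pp; have p1 := prime_gt1 pp.
have [->|m0] := posnP m; first by rewrite bin0 logn1.
have E : logn p (m.*2)`! = logn p 'C(m.*2, m) + (logn p m`!).*2.
  rewrite -(@bin_fact m.*2 m) -?addnn ?leq_addr// addnK.
  by rewrite !lognM ?muln_gt0 ?fact_gt0 ?bin_gt0 ?leq_addr// addnn.
have Em : logn p m`! = \sum_(1 <= k < m.*2.+1) m %/ p ^ k.
  rewrite logn_fact// (@big_cat_nat _ _ _ m.+1 1 m.*2.+1)//=; last by lia.
  rewrite [X in _ = _ + X]big_nat [X in _ = _ + X]big1 ?addn0// => k /andP[mk _].
  by rewrite divn_small// (leq_trans mk)// ltnW// ltn_expl.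
have -> : logn p 'C(m.*2, m) = \sum_(1 <= k < m.*2.+1) (m.*2 %/ p ^ k - (m %/ p ^ k).*2).
  have dbl : (logn p m`!).*2 = \sum_(1 <= k < m.*2.+1) (m %/ p ^ k).*2.
    by rewrite Em -mul2n big_distrr; apply: eq_bigr => k _; rewrite /= mul2n.
  rewrite -[LHS](addnK (logn p m`!).*2) -E logn_fact// dbl sumnB// => k _.
  rewrite -muln2 leq_divRL ?expn_gt0 ?prime_gt0// -[m.*2]muln2.
  by rewrite mulnAC leq_mul2r leq_trunc_div.
apply: (@leq_trans (\sum_(1 <= k < m.*2.+1) (k <= trunc_log p m.*2))).
  apply: leq_sum => k _; case: (leqP k (trunc_log p m.*2)) => [_|kT].
    have pk : 0 < p ^ k by rewrite expn_gt0 prime_gt0.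
    rewrite leq_subLR addn1 -ltnS -doubleS ltn_divLR// -doubleMl ltn_double mulSn.
    by rewrite {1}(divn_eq m (p ^ k)) addnC ltn_add2r ltn_pmod.
  rewrite divn_small ?sub0n//; apply: leq_trans (trunc_log_ltn _ p1) _.
  by rewrite leq_exp2l.
set K := trunc_log p m.*2.
have -> : \sum_(1 <= k < m.*2.+1) (k <= K) = count (fun k => k <= K) (index_iota 1 m.*2.+1).
  by rewrite -sum1_count [RHS]big_mkcond; apply: eq_bigr => k _; case: (k <= K).
rewrite -size_filter -[leqRHS](size_iota 1); apply: uniq_leq_size.
  by rewrite filter_uniq// iota_uniq.
by move=> k; rewrite mem_filter mem_index_iota mem_iota; lia.
Qed.

(** By [logn_central_bin] every p-part of the coefficient is at most 2m, and primes beyond 2m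
    contribute 1. *)
Lemma central_bin_le m : 'C(m.*2, m) <= m.*2 ^ nprimes m.*2.
Proof.
have [->|m0] := posnP m; first by [].
set C := 'C(m.*2, m); have C0 : 0 < C by rewrite bin_gt0 -addnn leq_addr.
rewrite -[leqLHS](partnT C0) (@widen_partn (maxn C m.*2)) ?leq_maxl//.
rewrite (@big_cat_nat _ _ _ m.*2.+1)//=; last by rewrite ltnS leq_maxr.
rewrite [X in _ * X]big_nat_cond [X in _ * X]big1 ?muln1 => [|p /andP[/andP[mp _] _]].
  rewrite big_mkord -(big_mkord xpredT (fun p => p ^ logn p C)) big_ltn// (_ : logn 0 C = 0)// expn0 mul1n.
  apply: (@leq_trans (\prod_(1 <= p < m.*2.+1 | prime p) m.*2)).
    rewrite [leqRHS]big_mkcond; apply: leq_prod => p _; case: ifP => pp; last first.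
      by rewrite /logn pp.
    rewrite (leq_trans _ (trunc_logP (prime_gt1 pp) _)) ?double_gt0//.
    by rewrite leq_exp2l ?prime_gt1// logn_central_bin.
  by rewrite big_const_seq /index_iota subn1 iter_muln muln1.
suff -> : logn p C = 0 by [].
case pp: (prime p); last by rewrite /logn pp.
apply/eqP; rewrite -leqn0; apply: leq_trans (logn_central_bin _ pp) _.
by rewrite leqn0 trunc_log_eq0; apply/orP; right; lia.
Qed.

Lemma leq_nprimes : {homo nprimes : m n / m <= n}.
Proof.
by move=> m n /subnK <-; rewrite addnC /nprimes iotaD count_cat leq_addr.
Qed.

Lemma chebyshev_lower n : 2 ^ n./2 <= n ^ nprimes n.
Proof.
have [->|n0] := posnP n; first by [].
have le2 : n./2.*2 <= n by rewrite -[leqRHS]odd_double_half leq_addl.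
apply: leq_trans (expn2_le_central_bin _) _; apply: leq_trans (central_bin_le _) _.
apply: (@leq_trans (n ^ nprimes n./2.*2)); first by case: (nprimes _) => // e; rewrite leq_exp2r.
by rewrite leq_pexp2l// leq_nprimes.
Qed.

End Chebyshev.

(** The constant is 6 = 3 * 2: n is at most 3 floor(n/2) for n >= 2, and ln 2 >= 1/2. *)
Lemma chebyshev_real (R : realType) (n : nat) : (2 <= n)%N ->
  n%:R <= 6 * (nprimes n)%:R * ln n%:R :> R.
Proof.
move=> n2; have n0 : (0 : R) < n%:R by rewrite ltr0n; lia.
have ln2 : 1 / 2 <= ln 2 :> R.
  have : ln (2^-1) <= 2^-1 - 1 :> R.
    have := @le_ln1Dx R (2^-1 - 1); rewrite [1 + _]addrC subrK; apply.
    by rewrite ltrBrDl subrr invr_gt0.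
  rewrite lnV ?posrE//; lra.
have H : n./2%:R * ln 2 <= (nprimes n)%:R * ln n%:R :> R.
  have p2 : (0 : R) < 2 ^+ n./2 by rewrite exprn_gt0.
  have pn : (0 : R) < n%:R ^+ nprimes n by rewrite exprn_gt0.
  rewrite !mulr_natl -!lnXn// ler_ln ?posrE// -!natrX ler_nat; exact: chebyshev_lower.
have h : n%:R <= 3 * n./2%:R :> R by rewrite -natrM ler_nat; lia.
have : n./2%:R * (1 / 2) <= n./2%:R * ln 2 :> R by rewrite ler_wpM2l.
by move: H h; rewrite -!mulrA; lra.
Qed.

(** * Integration over the unit cube *)

Section ContinuousArith.
Context {R : realType} {T : topologicalType}.
Implicit Types f g : T -> R.

Lemma continuous_add f g : continuous f -> continuous g ->
  continuous (fun x => f x + g x).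
Proof. by move=> cf cg x; exact: (cvgD (cf x) (cg x)). Qed.

Lemma continuous_sub f g : continuous f -> continuous g ->
  continuous (fun x => f x - g x).
Proof. by move=> cf cg x; exact: (cvgB (cf x) (cg x)). Qed.

Lemma continuous_mul f g : continuous f -> continuous g ->
  continuous (fun x => f x * g x).
Proof. by move=> cf cg x; exact: (cvgM (cf x) (cg x)). Qed.

Lemma continuous_scale (a : R) f : continuous f -> continuous (fun x => a * f x).
Proof. by move=> cf; apply: continuous_mul => //; exact: cst_continuous. Qed.

Lemma continuous_bigsum I (r : seq I) (F : I -> T -> R) :
  (forall i, continuous (F i)) -> continuous (fun x => \sum_(i <- r) F i x).
Proof.
move=> cF; elim: r => [|i r IH].
  by under eq_fun do rewrite big_nil; exact: cst_continuous.
by under eq_fun do rewrite big_cons; exact: continuous_add.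
Qed.

End ContinuousArith.

Lemma cvg_mx (R : numFieldType) (m n : nat) (T : Type) (F : set_system T)
    (FF : Filter F) (f : T -> 'M[R]_(m, n)) (M : 'M[R]_(m, n)) :
  (forall i j, (fun x => f x i j) @ F --> M i j) -> f @ F --> M.
Proof.
move=> fM; apply/cvg_ballP => eps eps0; rewrite /= near_simpl.
have : \forall x \near F, forall i j, ball (M i j) eps (f x i j).
  apply: filter_forall => i; apply: filter_forall => j.
  by have /cvg_ballP/(_ _ eps0) := fM i j.
by apply: filterS => x Mx; split.
Qed.

Section CubeIntegral.
Variable R : realType.
Local Notation mu := (@lebesgue_measure R).
Local Notation I01 := (`[0%R, 1%R]%classic : set R).

Lemma integrable01 (f : R -> R) : continuous f -> mu.-integrable I01 (EFin \o f).
Proof.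
move=> cf; apply: continuous_compact_integrable; first exact: segment_compact.
exact: continuous_subspaceT.
Qed.

Lemma Rintegral01_cst (r : R) : \int[mu]_(x in I01) r = r.
Proof.
have mu01 : lebesgue_measure I01 = 1%E :> \bar R.
  by rewrite lebesgue_measure_itv /= lte_fin ltr01 -EFinB subr0.
rewrite Rintegral_cst; last exact: measurable_itv.
exact: etrans (congr1 (fun z => r * fine z) mu01) (mulr1 r).
Qed.

Lemma compact_cube d : compact (@unit_cube R d).
Proof.
have -> : @unit_cube R d = [set v | forall i, I01 (v ord0 i)].
  by apply/seteqP; split=> v /= + j => /(_ j); rewrite in_itv.
exact: (@rV_compact R d (fun=> I01) (fun=> @segment_compact R 0 1)).
Qed.

Definition slice d (F : 'rV[R]_d.+1 -> R) (t : R) (x : 'rV[R]_d) : R :=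
  F (row_mx (t%:M : 'rV[R]_1) x).

Lemma continuous_row_mx d : continuous
  (fun p : R * 'rV[R]_d => row_mx (p.1%:M : 'rV[R]_1) p.2 : 'rV[R]_d.+1).
Proof.
move=> [t x]; apply: cvg_mx => i j /=.
rewrite mxE; under eq_fun do rewrite mxE.
case: (@splitP 1 d j) => k _ /=.
  rewrite mxE; under eq_fun do rewrite mxE.
  rewrite !ord1 eqxx mulr1n; under eq_fun do rewrite mulr1n; exact: cvg_fst.
by apply: (@cvg_comp _ _ _ snd (fun M : 'rV[R]_d => M i k));
  [exact: cvg_snd | exact: coord_continuous].
Qed.

Lemma continuous_slice2 d (F : 'rV[R]_d.+1 -> R) : continuous F ->
  continuous (fun p : R * 'rV[R]_d => slice F p.1 p.2).
Proof.
by move=> cF p; apply: continuous_comp; [exact: continuous_row_mx | exact: cF].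
Qed.

Lemma continuous_slice d (F : 'rV[R]_d.+1 -> R) (t : R) :
  continuous F -> continuous (slice F t).
Proof.
move=> /continuous_slice2 cF x.
have ct : {for x, continuous (fun x : 'rV[R]_d => (t, x))}.
  rewrite /continuous_at /prop_for; apply: (@cvg_pair _ _ _ (nbhs x) (nbhs t) (nbhs x)).
    exact: cvg_cst.
  exact: cvg_id.
exact: (@continuous_comp _ _ _ (fun x => (t, x)) (fun p => slice F p.1 p.2) x ct
  (cF (t, x))).
Qed.

(** Compactness of the cube makes the continuity in t uniform in x, as in the tube lemma. This is
    what allows the limit to pass under the inner integral. *)
Lemma slice_unif_cvg d (F : 'rV[R]_d.+1 -> R) (t0 e : R) : continuous F -> 0 < e ->
  \forall t \near t0, forall x, unit_cube x -> `|slice F t x - slice F t0 x| <= e.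
Proof.
move=> cF e0; have /compact_near_coveringP := @compact_cube d.
move=> /(_ R (nbhs t0) (fun t x => `|slice F t x - slice F t0 x| <= e) _) near_cube.
apply: near_cube => x _.
have c2 := continuous_slice2 cF.
have e20 : 0 < e / 2 by rewrite divr_gt0.
have /cvgrPdist_lt /(_ _ e20) := c2 (t0, x).
rewrite /= => -[[U V] /= [Ut Vx] UV].
exists (V, U) => // -[x' t] /= [Vx' Ut'].
have := UV (t, x') (conj Ut' Vx').
have := UV (t0, x') (conj (nbhs_singleton Ut) Vx').
rewrite /=; set a := slice F t0 x; set b := slice F t0 x'; set c := slice F t x'.
move=> ab ac; rewrite (_ : c - b = (a - b) - (a - c)); last by ring.
by rewrite (le_trans (ler_normB _ _))// [leRHS]splitr lerD// ltW.
Qed.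

Section Induction.
Variable d : nat.
Hypothesis IHD : forall F G : 'rV[R]_d -> R, continuous F -> continuous G ->
  cube_integral (fun x => F x + G x) = cube_integral F + cube_integral G.
Hypothesis IHle : forall F G : 'rV[R]_d -> R, continuous F -> continuous G ->
  (forall x, unit_cube x -> F x <= G x) -> cube_integral F <= cube_integral G.
Hypothesis IHc : forall r : R, cube_integral (fun _ : 'rV[R]_d => r) = r.

Lemma continuous_integral_slice_ind (F : 'rV[R]_d.+1 -> R) : continuous F ->
  continuous (fun t => cube_integral (slice F t)).
Proof.
move=> cF t0; apply/cvgrPdist_le => /= e e0.
near=> t; rewrite distrC.
have H : forall x, unit_cube x -> `|slice F t x - slice F t0 x| <= e.
  by near: t; exact: slice_unif_cvg.
have cst_cont (r : R) : continuous (fun _ : 'rV[R]_d => r).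
  exact: cst_continuous.
have cs t' := @continuous_slice _ F t' cF.
have addc (G : 'rV[R]_d -> R) : continuous G -> continuous (fun x => G x + e).
  by move=> cG; apply: continuous_add => //; exact: cst_continuous.
rewrite ler_distlC; apply/andP; split.
  rewrite lerBlDr -[X in _ + X](IHc e) -IHD//; apply: IHle => //; first exact: addc.
  by move=> x /H; rewrite ler_distl => /andP[]; lra.
rewrite -[X in _ + X](IHc e) -IHD//; apply: IHle => //; first exact: addc.
by move=> x /H; rewrite ler_distl => /andP[]; lra.
Unshelve. all: end_near. Qed.

Lemma cube_integralS (F : 'rV[R]_d.+1 -> R) :
  cube_integral F = \int[mu]_(t in I01) cube_integral (slice F t).
Proof. by []. Qed.

End Induction.

(** The properties are proved together: adding a variable requires the inner integral to be
    continuous, hence integrable, in that variable, and this continuity rests on additivity,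
    monotonicity and the value on constants one dimension lower. *)
Lemma cube_integral_props d :
  [/\ forall F G : 'rV[R]_d -> R, continuous F -> continuous G ->
        cube_integral (fun x => F x + G x) = cube_integral F + cube_integral G,
      forall (a : R) (F : 'rV[R]_d -> R), continuous F ->
        cube_integral (fun x => a * F x) = a * cube_integral F,
      forall F G : 'rV[R]_d -> R, continuous F -> continuous G ->
        (forall x, unit_cube x -> F x <= G x) -> cube_integral F <= cube_integral G &
      forall r : R, cube_integral (fun _ : 'rV[R]_d => r) = r].
Proof.
elim: d => [|d [IHD IHZ IHle IHc]].
  by split=> //= F G _ _; apply => -[].
have cI := continuous_integral_slice_ind IHD IHle IHc.
split.
- move=> F G cF cG; rewrite !cube_integralS -RintegralD//.
  + apply: eq_Rintegral => t _; rewrite /slice.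
    by rewrite IHD//; exact: continuous_slice.
  + by apply: integrable01; exact: cI.
  + by apply: integrable01; exact: cI.
- move=> a F cF; rewrite !cube_integralS -RintegralZl//; last first.
    by apply: integrable01; exact: cI.
  by apply: eq_Rintegral => t _; rewrite IHZ//; exact: continuous_slice.
- move=> F G cF cG FG; rewrite !cube_integralS; apply: le_Rintegral => //.
  + by apply: integrable01; exact: cI.
  + by apply: integrable01; exact: cI.
  + move=> t; rewrite /= in_itv /= => t01; apply: IHle; try exact: continuous_slice.
    move=> x cx; apply: FG => j; rewrite mxE.
    by case: (@splitP 1 d j) => k _; [rewrite mxE ord1 eqxx mulr1n | exact: cx].
- move=> r; rewrite cube_integralS.
  under eq_Rintegral do rewrite /slice IHc.
  exact: Rintegral01_cst.
Qed.

Lemma cube_integralD d (F G : 'rV[R]_d -> R) : continuous F -> continuous G ->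
  cube_integral (fun x => F x + G x) = cube_integral F + cube_integral G.
Proof. by have [+ _ _ _] := cube_integral_props d; apply. Qed.

Lemma cube_integralZ d (a : R) (F : 'rV[R]_d -> R) : continuous F ->
  cube_integral (fun x => a * F x) = a * cube_integral F.
Proof. by have [_ + _ _] := cube_integral_props d; apply. Qed.

Lemma le_cube_integral d (F G : 'rV[R]_d -> R) : continuous F -> continuous G ->
  (forall x, unit_cube x -> F x <= G x) -> cube_integral F <= cube_integral G.
Proof. by have [_ _ + _] := cube_integral_props d; apply. Qed.

Lemma cube_integral_cst d (r : R) : cube_integral (fun _ : 'rV[R]_d => r) = r.
Proof. by have [_ _ _ +] := cube_integral_props d; apply. Qed.

End CubeIntegral.

(** * Characters and Fourier coefficients *)

Section Cis.
Context {R : realType}.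
Implicit Types (t s : R) (z w : R[i]).

Lemma Re_addc z w : complex.Re (z + w) = complex.Re z + complex.Re w.
Proof. by case: z; case: w. Qed.

Lemma Im_addc z w : complex.Im (z + w) = complex.Im z + complex.Im w.
Proof. by case: z; case: w. Qed.

Lemma Re_mulc z w : complex.Re (z * w) =
  complex.Re z * complex.Re w - complex.Im z * complex.Im w.
Proof. by case: z; case: w. Qed.

Lemma Im_mulc z w : complex.Im (z * w) =
  complex.Re z * complex.Im w + complex.Im z * complex.Re w.
Proof. by case: z => a b; case: w => c e /=; rewrite mulrC. Qed.

Lemma complex_eta z : Complex (complex.Re z) (complex.Im z) = z.
Proof. by case: z. Qed.

Lemma cisD t s : cis (t + s) = cis t * cis s.
Proof.
apply/eqP; rewrite eq_complex /= cosD sinD eqxx /=; apply/eqP; ring.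
Qed.

Lemma cis0 : cis (0 : R) = 1.
Proof. by rewrite /cis cos0 sin0. Qed.

Lemma cisN t : cis (- t) = (cis t)^*%C.
Proof. by rewrite /cis cosN sinN. Qed.

Lemma normc_cis t : ComplexField.Normc.normc (cis t) = 1.
Proof. by rewrite /= cos2Dsin2 sqrtr1. Qed.

Lemma cis_mulN t : cis t * cis (- t) = 1.
Proof. by rewrite -cisD subrr cis0. Qed.

Lemma cis_nat n t : cis (n%:R * t) = cis t ^+ n.
Proof.
by elim: n => [|n IH]; rewrite ?mul0r ?cis0// exprS -IH -cisD mulrSr mulrDl mul1r addrC.
Qed.

Lemma cis2pi : cis (2 * pi : R) = 1.
Proof. by rewrite /cis mulr_natl cos2pi sin2pi. Qed.

Lemma cis_int (m : int) : cis (2 * pi * m%:~R : R) = 1.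
Proof.
case: m => n; first by rewrite mulrC -pmulrn cis_nat cis2pi expr1n.
rewrite NegzE mulrNz mulrN cisN mulrC -pmulrn cis_nat cis2pi expr1n.
exact: conjc1.
Qed.

Lemma normc_le_ReIm z :
  ComplexField.Normc.normc z <= `|complex.Re z| + `|complex.Im z|.
Proof.
case: z => a b /=.
rewrite -(ler_pXn2r (ltn0Sn 1)) ?nnegrE ?sqrtr_ge0 ?addr_ge0 ?normr_ge0//.
rewrite sqr_sqrtr ?addr_ge0 ?sqr_ge0// sqrrD !real_normK ?num_real//.
by rewrite lerD2r lerDl mulrn_wge0// mulr_ge0.
Qed.

Lemma normc_ge0 z : 0 <= ComplexField.Normc.normc z.
Proof. by case: z => a b /=; exact: sqrtr_ge0. Qed.

Lemma normc_real t : ComplexField.Normc.normc (t%:C)%C = `|t|.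
Proof. by rewrite /= expr0n addr0 sqrtr_sqr. Qed.

Lemma normc_sum I (r : seq I) (P : pred I) (F : I -> R[i]) :
  ComplexField.Normc.normc (\sum_(i <- r | P i) F i) <=
  \sum_(i <- r | P i) ComplexField.Normc.normc (F i).
Proof.
elim/big_rec2: _ => [|i x y _ IH]; first by rewrite ComplexField.Normc.normc0.
by apply: le_trans (le_normcD _ _) _; rewrite lerD2l.
Qed.

End Cis.

Section Phase.
Context {R : realType} {d : nat}.
Implicit Types (k h : 'rV[int]_d) (x y : 'rV[R]_d).

Lemma phaseDl k h x : phase (k + h) x = phase k x + phase h x.
Proof.
rewrite /phase -mulrDr -big_split; congr (_ * _); apply: eq_bigr => j _ /=.
by rewrite mxE intrD mulrDl.
Qed.

Lemma phaseNl k x : phase (- k) x = - phase k x.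
Proof.
rewrite /phase -mulrN -sumrN; congr (_ * _); apply: eq_bigr => j _ /=.
by rewrite mxE rmorphN mulNr.
Qed.

Lemma phaseDr k x y : phase k (x + y) = phase k x + phase k y.
Proof.
rewrite /phase -mulrDr -big_split; congr (_ * _); apply: eq_bigr => j _ /=.
by rewrite mxE mulrDr.
Qed.

Lemma phaseNr k x : phase k (- x) = - phase k x.
Proof.
rewrite /phase -mulrN -sumrN; congr (_ * _); apply: eq_bigr => j _ /=.
by rewrite mxE mulrN.
Qed.

Lemma phase0 x : phase 0 x = 0.
Proof. by rewrite /phase big1 ?mulr0// => j _; rewrite mxE mul0r. Qed.

Lemma phase_delta i x : phase (delta_mx 0 i) x = 2 * pi * x 0 i.
Proof.
rewrite /phase (bigD1 i)//= mxE !eqxx mul1r big1 ?addr0// => j ji.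
by rewrite mxE eqxx (negbTE ji) mul0r.
Qed.

Lemma continuous_phase k : continuous (@phase R d k).
Proof.
apply: continuous_scale; apply: continuous_bigsum => j.
by apply: continuous_scale; exact: coord_continuous.
Qed.

End Phase.

Section ComplexIntegral.
Context {R : realType}.

Definition ccontinuous (T : topologicalType) (f : T -> R[i]) : Prop :=
  continuous (fun x => complex.Re (f x)) /\ continuous (fun x => complex.Im (f x)).

Definition ccube_integral d (f : 'rV[R]_d -> R[i]) : R[i] :=
  Complex (cube_integral (fun x => complex.Re (f x)))
          (cube_integral (fun x => complex.Im (f x))).

Section Arith.
Variable T : topologicalType.
Implicit Types f g : T -> R[i].

Lemma ccontinuousD f g : ccontinuous f -> ccontinuous g ->
  ccontinuous (fun x => f x + g x).
Proof.
move=> [fR fI] [gR gI]; split; [under eq_fun do rewrite Re_addc | under eq_fun do rewrite Im_addc];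
  exact: continuous_add.
Qed.

Lemma ccontinuousM f g : ccontinuous f -> ccontinuous g ->
  ccontinuous (fun x => f x * g x).
Proof.
move=> [fR fI] [gR gI]; split.
  under eq_fun do rewrite Re_mulc; apply: continuous_sub; exact: continuous_mul.
under eq_fun do rewrite Im_mulc; apply: continuous_add; exact: continuous_mul.
Qed.

Lemma ccontinuous_cst (c : R[i]) : ccontinuous (fun _ : T => c).
Proof. by split; exact: cst_continuous. Qed.

Lemma ccontinuous_sum I (r : seq I) (F : I -> T -> R[i]) :
  (forall i, ccontinuous (F i)) -> ccontinuous (fun x => \sum_(i <- r) F i x).
Proof.
move=> cF; elim: r => [|i r IH].
  by under eq_fun do rewrite big_nil; exact: ccontinuous_cst.
by under eq_fun do rewrite big_cons; exact: ccontinuousD.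
Qed.

Lemma ccontinuous_cis (f : T -> R) : continuous f -> ccontinuous (fun x => cis (f x)).
Proof.
move=> cf; split=> x /=; apply: continuous_comp; [exact: cf | exact: continuous_cos
  | exact: cf | exact: continuous_sin].
Qed.

End Arith.

Lemma ccube_integralD d (f g : 'rV[R]_d -> R[i]) : ccontinuous f -> ccontinuous g ->
  ccube_integral (fun x => f x + g x) = ccube_integral f + ccube_integral g.
Proof.
move=> [fR fI] [gR gI]; apply/eqP; rewrite eq_complex /=.
under eq_fun do rewrite Re_addc; under [in X in _ && X]eq_fun do rewrite Im_addc.
by rewrite !cube_integralD// !eqxx.
Qed.

Lemma ccube_integralZ d (c : R[i]) (f : 'rV[R]_d -> R[i]) : ccontinuous f ->
  ccube_integral (fun x => c * f x) = c * ccube_integral f.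
Proof.
move=> [fR fI]; apply/eqP; rewrite eq_complex Re_mulc Im_mulc /=.
under eq_fun do rewrite Re_mulc -mulNr; under [in X in _ && X]eq_fun do rewrite Im_mulc.
by rewrite !cube_integralD ?cube_integralZ ?mulNr ?eqxx//; exact: continuous_scale.
Qed.

Lemma ccube_integral_sum d I (r : seq I) (F : I -> 'rV[R]_d -> R[i]) :
  (forall i, ccontinuous (F i)) ->
  ccube_integral (fun x => \sum_(i <- r) F i x) = \sum_(i <- r) ccube_integral (F i).
Proof.
move=> cF; elim: r => [|i r IH].
  rewrite big_nil /ccube_integral; under eq_fun do rewrite big_nil /=.
  by under [X in Complex _ (cube_integral X)]eq_fun do rewrite big_nil /=;
    rewrite cube_integral_cst.
under eq_fun do rewrite big_cons.
by rewrite big_cons ccube_integralD// ?IH//; exact: ccontinuous_sum.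
Qed.

Lemma ccontinuous_cis_phase d (k : 'rV[int]_d) :
  ccontinuous (fun x : 'rV[R]_d => cis (phase k x)).
Proof. by apply: ccontinuous_cis; exact: continuous_phase. Qed.

Lemma fourier_coefE d (f : 'rV[R]_d -> R[i]) k :
  fourier_coef f k = ccube_integral (fun x => f x * cis (phase (- k) x)).
Proof. by rewrite /fourier_coef; under eq_fun do rewrite -phaseNl;
  under [X in Complex _ (cube_integral X)]eq_fun do rewrite -phaseNl. Qed.

End ComplexIntegral.

Section FourierOrthogonality.
Context {R : realType}.
Local Notation mu := (@lebesgue_measure R).

Lemma Rintegral01_cossin (m : int) : m != 0 ->
  \int[mu]_(t in `[0%R, 1%R]) cos (2 * pi * m%:~R * t) = 0 /\
  \int[mu]_(t in `[0%R, 1%R]) sin (2 * pi * m%:~R * t) = 0.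
Proof.
move=> m0; set w := 2 * pi * m%:~R.
have w0 : w != 0 by rewrite !mulf_neq0// ?intr_eq0// gt_eqF// pi_gt0.
have cw : continuous (fun t : R => w * t) by apply: continuous_scale => x; exact: cvg_id.
have [cosw sinw] : cos w = 1 /\ sin w = 0 by have := @cis_int R m; rewrite -/w => -[].
have FTC (f F : R -> R) : continuous f -> (forall t : R, is_derive t 1 F (f t)) ->
    F 1 = F 0 -> \int[mu]_(t in `[0%R, 1%R]) f t = 0.
  move=> cf dF F01; rewrite /Rintegral (@continuous_FTC2 R f F)//.
  - by rewrite F01 -EFinB subrr.
  - exact: continuous_subspaceT.
  - have cF : continuous F.
      by move=> t; apply: differentiable_continuous; apply/derivable1_diffP;
        have [] := dF t.
    split; first by move=> t _; have [] := dF t.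
    - exact: cvg_at_right_filter (cF 0).
    - exact: cvg_at_left_filter (cF 1).
  - by move=> t _; rewrite derive1E; exact: derive_val.
split.
  apply: (FTC _ (fun t => w^-1 * sin (w * t))).
  - by move=> t; apply: continuous_comp; [exact: cw | exact: continuous_cos].
  - move=> t; apply: is_derive_eq.
    by rewrite /GRing.scale /=; field.
  - by rewrite mulr0 mulr1 sin0 sinw.
apply: (FTC _ (fun t => - w^-1 * cos (w * t))).
- by move=> t; apply: continuous_comp; [exact: cw | exact: continuous_sin].
- move=> t; apply: is_derive_eq.
  by rewrite /GRing.scale /=; field.
- by rewrite mulr0 mulr1 cos0 cosw.
Qed.

Lemma phase_row_mx d (k : 'rV[int]_(d.+1)) (t : R) (x : 'rV[R]_d) :
  phase k (row_mx (t%:M : 'rV[R]_1) x) =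
  2 * pi * (k 0 0)%:~R * t + phase (@rsubmx _ 1 1 d k) x.
Proof.
rewrite /phase big_ord_recl mulrDr; congr (_ + _ * _).
  by rewrite mxE; case: (@splitP 1 d ord0) => // j _; rewrite ord1 mxE eqxx mulr1n mulrA.
apply: eq_bigr => i _; rewrite !mxE.
have -> : rshift 1 i = lift ord0 i by exact: val_inj.
congr (_ * _); case: (@splitP 1 d (lift ord0 i)) => j /=.
  by case: j => -[].
by rewrite /bump leq0n !add1n => -[/val_inj ->].
Qed.

(** The character factors along the first coordinate, so induction on the dimension reduces
    orthogonality to the one-variable integrals of cosine and sine. *)
Lemma ccube_integral_cis d (k : 'rV[int]_d) :
  ccube_integral (fun x : 'rV[R]_d => cis (phase k x)) = (k == 0)%:R.
Proof.
elim: d k => [|d IH] k.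
  rewrite [k]thinmx0 eqxx /ccube_integral /= phase0.
  exact: cis0.
set k' := @rsubmx _ 1 1 d k.
have E t : ccube_integral
    (fun x : 'rV[R]_d => cis (phase k (row_mx (t%:M : 'rV[R]_1) x))) =
    ((k' == 0)%:R : R)%:C%C * cis (2 * pi * (k 0 0)%:~R * t).
  under [X in ccube_integral X]eq_fun do rewrite phase_row_mx cisD.
  rewrite ccube_integralZ; last exact: ccontinuous_cis_phase.
  by rewrite IH mulrC; congr (_ * _); case: (_ == _).
have ER t : cube_integral (fun x : 'rV[R]_d =>
    complex.Re (cis (phase k (row_mx (t%:M : 'rV[R]_1) x)))) =
    (k' == 0)%:R * cos (2 * pi * (k 0 0)%:~R * t).
  by have := congr1 (@complex.Re R) (E t); rewrite Re_mulc /= mul0r subr0.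
have EI t : cube_integral (fun x : 'rV[R]_d =>
    complex.Im (cis (phase k (row_mx (t%:M : 'rV[R]_1) x)))) =
    (k' == 0)%:R * sin (2 * pi * (k 0 0)%:~R * t).
  by have := congr1 (@complex.Im R) (E t); rewrite Im_mulc /= mul0r addr0.
have k0E : (k == 0) = (k 0 0 == 0) && (k' == 0).
  rewrite /k'; apply/eqP/andP => [->|[/eqP k00 /eqP k'0]].
    by rewrite mxE eqxx; split=> //; apply/eqP/matrixP => i j; rewrite !mxE.
  apply/rowP => i; rewrite mxE; have [j ->|] := unliftP ord0 i; last by move=> ->.
  have := congr1 (fun M : 'rV[int]_d => M 0 j) k'0; rewrite !mxE => <-.
  by congr (k _ _); apply: val_inj.
rewrite /ccube_integral /=.
under eq_Rintegral do rewrite ER.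
under [X in Complex _ X]eq_Rintegral do rewrite EI.
have cw : continuous (fun t : R => 2 * pi * (k 0 0)%:~R * t).
  by apply: continuous_scale => x; exact: cvg_id.
rewrite !RintegralZl//; first last.
- by apply: integrable01 => t; apply: continuous_comp; [exact: cw | exact: continuous_cos].
- by apply: integrable01 => t; apply: continuous_comp; [exact: cw | exact: continuous_sin].
rewrite k0E; have [k00|k00] := eqVneq (k 0 0) 0; last first.
  by have [-> ->] := Rintegral01_cossin k00; rewrite !mulr0.
rewrite k00; under eq_Rintegral do rewrite mulr0 mul0r cos0.
under [X in Complex _ (_ * X)]eq_Rintegral do rewrite mulr0 mul0r sin0.
by rewrite !Rintegral01_cst mulr0 mulr1; case: (_ == _).
Qed.

End FourierOrthogonality.

(** * Fejer means *)

Section Korovkin.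
Context {R : realType} {d : nat}.
Implicit Types (x y : 'rV[R]_d).

(** The periods of F form an additive group that contains the unit vectors. *)
Lemma periodic_int (T : Type) (F : 'rV[R]_d -> T) :
  (forall x j, F (x + delta_mx 0 j) = F x) ->
  forall (z : 'rV[int]_d) x, F (x + map_mx intr z) = F x.
Proof.
move=> perF.
pose per (v : 'rV[R]_d) := forall x, F (x + v) = F x.
have per0 : per 0 by move=> x; rewrite addr0.
have perD u v : per u -> per v -> per (u + v).
  by move=> pu pv x; rewrite addrA pv pu.
have perN u : per u -> per (- u) by move=> pu x; rewrite -(pu (x - u)) subrK.
have perMn u n : per u -> per (u *+ n).
  by move=> pu; elim: n => [|n IH]; rewrite ?mulr0n// mulrS; exact: perD.
move=> z; rewrite -/(per _).
have -> : map_mx intr z = \sum_j (delta_mx 0 j : 'rV[R]_d) *~ z 0 j.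
  apply/rowP => i; rewrite mxE summxE (bigD1 i)//= big1 => [|j ji].
    by rewrite addr0 -[in RHS]scaler_int !mxE !eqxx mulr1.
  by rewrite -scaler_int !mxE eqxx eq_sym (negbTE ji) mulr0.
elim/big_ind: _ => // j _; case: (z 0 j) => n.
  by apply: perMn => x; exact: perF.
by rewrite NegzE mulrNz; apply: perN; apply: perMn => x; exact: perF.
Qed.

(** Near y modulo the integers, continuity gives [e]. Elsewhere some coordinate of x - y stays at
    distance at least [s] from the integers, so the cosine sum is at least [kap] and a multiple of
    it dominates the bounded difference. A positive kernel then has to be tested only on 1 and on
    these cosines. *)
Lemma korovkin_bound (F : 'rV[R]_d -> R) y (e : R) :
  continuous F -> (forall x j, F (x + delta_mx 0 j) = F x) -> 0 < e ->
  exists2 C, 0 <= C & forall x, unit_cube x ->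
    `|F x - F y| <= e + C * \sum_i (1 - cos (2 * pi * (x 0 i - y 0 i))).
Proof.
move=> cF perF e0.
have /cvgrPdist_le /(_ _ e0) /nbhs_ballP[r /= r0 Fr] := cF y.
(* The cap at 1/2 keeps 2 pi s inside [0, pi], where cosine is decreasing. *)
pose s := Num.min r (1 / 2).
have s0 : 0 < s by rewrite lt_min r0 divr_gt0.
have s12 : s <= 1 / 2 by rewrite ge_min lexx orbT.
have pi0 := @pi_gt0 R.
pose kap := 1 - cos (2 * pi * s).
have kap0 : 0 < kap.
  rewrite subr_gt0 -{2}(@cos0 R) ltr_cos ?mulr_gt0// ?in_itv/= ?lexx ?pi_ge0//.
  apply/andP; split; first by rewrite !mulr_ge0 ?pi_ge0// ltW.
  by rewrite mulrAC; nra.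
have [B Bge] : exists B, forall x, unit_cube x -> `|F x - F y| <= B.
  have cFy : {within (@unit_cube R d), continuous F} by exact: continuous_subspaceT.
  have /compact_bounded[M [_ /(_ (M + 1))]] := continuous_compact cFy (@compact_cube R d).
  rewrite ltrDl ltr01 => /(_ isT) HM.
  exists (M + 1 + `|F y|) => x cx; rewrite (le_trans (ler_normB _ _))// lerD2r.
  by apply: HM; exists x.
have B'0 : 0 <= Num.max B 0 by rewrite le_max lexx orbT.
exists (Num.max B 0 / kap); first by rewrite divr_ge0// ltW.
move=> x cx.
have c0 i : 0 <= 1 - cos (2 * pi * (x 0 i - y 0 i)) by rewrite subr_ge0 cos_le1.
(* [z] is a nearest integer vector to x - y, so every [u i] lies in [-1/2, 1/2]; periodicity allows
   x to be replaced by x - z. *)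
pose z : 'rV[int]_d := \row_i Num.floor (x 0 i - y 0 i + 1 / 2).
pose u i := x 0 i - y 0 i - (z 0 i)%:~R.
have u12 i : `|u i| <= 1 / 2.
  rewrite /u mxE ler_norml; set w := x 0 i - y 0 i.
  have := floor_le_tmp (w + 1 / 2); have := floorD1_gt (w + 1 / 2); rewrite intrD; lra.
have [small|/existsNP[i big]] := pselect (forall i, `|u i| < s).
  rewrite -(periodic_int perF (- z)); apply: (@le_trans _ _ e).
    rewrite distrC; apply: Fr; split=> // i' j; rewrite ord1 !mxE rmorphN.
    rewrite /ball /= -(opprK (y 0 j - _)) normrN.
    have := small j; rewrite /u lt_min => /andP[+ _].
    by rewrite mxE; apply: le_lt_trans; rewrite le_eqVlt; apply/orP; left; apply/eqP;
       congr `|_|; ring.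
  by rewrite lerDl mulr_ge0 ?divr_ge0 ?sumr_ge0// ltW.
have kapi : kap <= 1 - cos (2 * pi * (x 0 i - y 0 i)).
  have -> : cos (2 * pi * (x 0 i - y 0 i)) = cos (2 * pi * u i).
    have : cis (2 * pi * (x 0 i - y 0 i)) = cis (2 * pi * u i).
      rewrite (_ : 2 * pi * (x 0 i - y 0 i) = 2 * pi * u i + 2 * pi * (z 0 i)%:~R).
        by rewrite cisD cis_int mulr1.
      by rewrite /u; ring.
    by case.
  rewrite lerB// -(cos_norm (2 * pi * u i)) !normrM [ `|2| ]ger0_norm// [ `|pi| ]ger0_norm ?pi_ge0//.
  have su : s <= `|u i| by rewrite leNgt; exact/negP.
  have v12 := u12 i; move: su; rewrite le_eqVlt => /predU1P[->//|sv].
  rewrite ltW// ltr_cos ?ltr_pM2l ?mulr_gt0// in_itv /= !mulr_ge0 ?pi_ge0 ?(ltW s0)//=.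
    by rewrite mulrAC ler_piMl ?pi_ge0//; lra.
  by rewrite mulrAC ler_piMl ?pi_ge0//; lra.
have sumC : kap <= \sum_i (1 - cos (2 * pi * (x 0 i - y 0 i))).
  by rewrite (bigD1 i)//= (le_trans kapi)// lerDl sumr_ge0.
apply: (le_trans (Bge x cx)); rewrite -[leLHS]add0r lerD ?(ltW e0)//.
rewrite mulrAC ler_pdivlMr//; apply: ler_pM => //; last by rewrite le_max lexx.
- exact: le_trans (normr_ge0 _) (Bge x cx).
- exact: ltW.
Qed.

End Korovkin.

(** Overwriting coordinate i by an arbitrary value is injective on pairs (vector of B, value). The
    bound serves both for the boundary layer of the Fejer box and for counting generating vectors
    with a given alias. *)
Lemma card_determined_by_others (T : finType) (d : nat) (i : 'I_d)
    (B : {set 'rV[T]_d}) :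
  {in B &, forall v w : 'rV[T]_d, (forall j, j != i -> v 0 j = w 0 j) -> v = w} ->
  (#|B| * #|T| <= #|T| ^ d)%N.
Proof.
move=> Binj.
pose upd (p : 'rV[T]_d * T) : 'rV[T]_d := \row_j (if j == i then p.2 else p.1 0 j).
have upd_inj : {in finset.setX B [set: T]%SET &, injective upd}.
  move=> [v s] [w t] /finset.setXP[/= vB _] /finset.setXP[/= wB _] /rowP E.
  have -> : v = w.
    by apply: Binj => // j ji; have := E j; rewrite !mxE (negbTE ji).
  by congr (_, _); have := E i; rewrite !mxE eqxx.
rewrite -cardsT -cardsX -(card_in_imset upd_inj).
by rewrite cardsT (leq_trans (max_card _))// card_mx mul1n.
Qed.

Section Fejer.
Context {R : realType} {d : nat}.
Variable n : nat.
Local Notation box := ('rV['I_n.+1]_d).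
Implicit Types (j l : box) (k h : 'rV[int]_d) (x y : 'rV[R]_d).

Definition box_freq (j : box) : 'rV[int]_d := map_mx (fun i : 'I_n.+1 => (i : nat)%:Z) j.

Definition fejer_weight : R := #|{: box}|%:R^-1.

(** The squared modulus of the sum of the characters in the box {0, ..., n}^d, over their number.
    This equals the product of one-dimensional Fejer kernels, in a form that makes positivity
    immediate. *)
Definition fejer_kernel (t : 'rV[R]_d) : R :=
  fejer_weight * ((\sum_j cos (phase (box_freq j) t)) ^+ 2 +
                  (\sum_j sin (phase (box_freq j) t)) ^+ 2).

Definition fejer_mean (f : 'rV[R]_d -> R[i]) (y : 'rV[R]_d) : R[i] :=
  ccube_integral (fun x => f x * (fejer_kernel (y - x))%:C%C).

Lemma box_freq_inj : injective box_freq.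
Proof.
move=> j l /rowP E; apply/rowP => i; have := E i; rewrite !mxE => -[].
exact: val_inj.
Qed.

Lemma card_box_gt0 : (0 < #|{: box}|)%N.
Proof. by rewrite card_mx card_ord expn_gt0. Qed.

Lemma fejer_weight_gt0 : 0 < fejer_weight.
Proof. by rewrite invr_gt0 ltr0n card_box_gt0. Qed.

Lemma fejer_kernel_ge0 t : 0 <= fejer_kernel t.
Proof. by rewrite mulr_ge0 ?(ltW fejer_weight_gt0)// addr_ge0 ?sqr_ge0. Qed.

Lemma fejer_kernelE t : (fejer_kernel t)%:C%C = (fejer_weight)%:C%C *
  \sum_j \sum_l cis (phase (box_freq j - box_freq l) t).
Proof.
rewrite /fejer_kernel rmorphM; congr (_ * _).
pose z := \sum_j cis (phase (box_freq j) t).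
have zE : z = Complex (\sum_j cos (phase (box_freq j) t)) (\sum_j sin (phase (box_freq j) t)).
  rewrite /z; elim/big_rec3: _ => // j a b c _ ->.
  by apply/eqP; rewrite eq_complex /= !eqxx.
transitivity (z * z^*%C).
  rewrite zE; apply/eqP; rewrite eq_complex /=; apply/andP; split; apply/eqP; ring.
rewrite /z rmorph_sum mulr_suml; apply: eq_bigr => j _.
rewrite mulr_sumr; apply: eq_bigr => l _.
by rewrite phaseDl cisD phaseNl cisN.
Qed.

Lemma continuous_fejer_kernel y : continuous (fun x => fejer_kernel (y - x)).
Proof.
have cph k : continuous (fun x => phase k (y - x)).
  under eq_fun do rewrite phaseDr phaseNr.
  by apply: continuous_sub; [exact: cst_continuous | exact: continuous_phase].
apply: continuous_scale; apply: continuous_add; apply: continuous_mul;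
  apply: continuous_bigsum => j x; apply: continuous_comp;
  by [exact: cph | exact: continuous_cos | exact: continuous_sin].
Qed.

Lemma fejer_meanE (f : 'rV[R]_d -> R[i]) y : ccontinuous f ->
  fejer_mean f y = (fejer_weight)%:C%C * \sum_j \sum_l
    fourier_coef f (box_freq j - box_freq l) * cis (phase (box_freq j - box_freq l) y).
Proof.
move=> cf; rewrite /fejer_mean.
have cfc k : ccontinuous (fun x => f x * cis (phase (- k) x)).
  by apply: ccontinuousM => //; exact: ccontinuous_cis_phase.
have cF k : ccontinuous (fun x => cis (phase k y) * (f x * cis (phase (- k) x))).
  by apply: ccontinuousM => //; exact: ccontinuous_cst.
under [X in ccube_integral X]eq_fun => x.
  rewrite fejer_kernelE mulrCA mulr_sumr.
  under eq_bigr => j _.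
    rewrite mulr_sumr; under eq_bigr => l _.
      rewrite phaseDr phaseNr -phaseNl cisD mulrCA.
    over.
  over.
over.
rewrite ccube_integralZ; last by do 2!apply: ccontinuous_sum => ?.
congr (_ * _); rewrite ccube_integral_sum; last by move=> j; apply: ccontinuous_sum.
apply: eq_bigr => j _; rewrite ccube_integral_sum//.
by apply: eq_bigr => l _; rewrite ccube_integralZ// -fourier_coefE mulrC.
Qed.

Lemma fourier_coef_cis h k :
  fourier_coef (fun x => cis (phase h x) : R[i]) k = (h == k)%:R.
Proof.
rewrite fourier_coefE; under [X in ccube_integral X]eq_fun do rewrite -cisD -phaseDl.
by rewrite ccube_integral_cis subr_eq0.
Qed.

Lemma fejer_mean_cis h y : fejer_mean (fun x => cis (phase h x)) y =
  (fejer_weight * #|[set p : box * box | box_freq p.1 - box_freq p.2 == h]%SET|%:R)%:C%C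
  * cis (phase h y).
Proof.
rewrite fejer_meanE; last exact: ccontinuous_cis_phase.
rewrite rmorphM -mulrA; congr (_ * _).
rewrite pair_bigA /= (eq_bigr (fun p : box * box =>
  (box_freq p.1 - box_freq p.2 == h)%:R * cis (phase h y))); last first.
  by move=> p _; rewrite fourier_coef_cis [h == _]eq_sym; case: eqP => [->//|]; rewrite !mul0r.
rewrite -mulr_suml -natr_sum rmorph_nat; congr (_%:R * _).
by rewrite -sum1_card [in RHS]big_mkcond /=; apply: eq_bigr => p _; rewrite inE; case: eqP.
Qed.

Lemma card_box_diff0 :
  #|[set p : box * box | box_freq p.1 - box_freq p.2 == 0]%SET| = #|{: box}|.
Proof.
rewrite -(card_imset _ (f := fun j : box => (j, j))); last by move=> j l [].
apply: eq_card => -[j l]; rewrite !inE subr_eq0 /=; apply/eqP/imsetP => [/box_freq_inj->|].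
  by exists l.
by move=> [? _ [-> ->]].
Qed.

(** Every l outside the top layer l_i = n yields the pair (l + e_i, l), and that layer is at most a
    fraction 1/(n+1) of the box. *)
Lemma card_box_diff_delta (i : 'I_d) :
  1 - n.+1%:R^-1 <= fejer_weight *
    #|[set p : box * box | box_freq p.1 - box_freq p.2 == delta_mx 0 i]%SET|%:R.
Proof.
set D := [set p : box * box | _]%SET.
pose last_i : {set box} := [set l : box | l 0 i == ord_max]%SET.
have last_card : (#|last_i| * n.+1 <= #|{: box}|)%N.
  have := @card_determined_by_others 'I_n.+1 d i last_i.
  rewrite card_ord card_mx card_ord mul1n; apply => v w; rewrite !inE => /eqP vi /eqP wi vw.
  by apply/rowP => j; have [->|/vw//] := eqVneq j i; rewrite vi wi.
have D_card : (#|{: box}| - #|last_i| <= #|D|)%N.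
  rewrite -cardsT -cardsDS ?subsetT// finset.setTD.
  pose up (l : box) : box := \row_j (if j == i then inord (l 0 j).+1 else l 0 j).
  rewrite -(card_imset _ (f := fun l : box => (up l, l))); last by move=> l m [].
  apply/subset_leq_card/fintype.subsetP => -[j l] /imsetP[m + [-> ->]].
  rewrite !inE => mi /=; rewrite subr_eq addrC; apply/eqP/rowP => r; rewrite !mxE eqxx.
  have [->|ri] := eqVneq r i; last by rewrite addr0.
  rewrite inordK ?addn1 ?PoszD ?intS 1?addrC// ltnS ltn_neqAle -ltnS ltn_ord andbT.
  by apply: contraNneq mi => E; apply/eqP/val_inj.
have box0 : (0 : R) < #|{: box}|%:R by rewrite ltr0n card_box_gt0.
rewrite /fejer_weight [leRHS]mulrC ler_pdivlMr// mulrBl mul1r lerBlDr -lerBlDl.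
rewrite ler_pdivlMl ?ltr0n//.
apply: (@le_trans _ _ (n.+1%:R * #|last_i|%:R)).
  by rewrite ler_wpM2l ?ler0n// lerBlDr -natrD ler_nat -leq_subLR.
by rewrite -natrM ler_nat mulnC.
Qed.

End Fejer.

Section FejerConvergence.
Context {R : realType} {d : nat}.

Lemma cube_integral_bigsum I (r : seq I) (F : I -> 'rV[R]_d -> R) :
  (forall i, continuous (F i)) ->
  cube_integral (fun x => \sum_(i <- r) F i x) = \sum_(i <- r) cube_integral (F i).
Proof.
move=> cF; elim: r => [|i r IH].
  by rewrite big_nil; under eq_fun do rewrite big_nil; rewrite cube_integral_cst.
under eq_fun do rewrite big_cons.
by rewrite big_cons cube_integralD// ?IH//; exact: continuous_bigsum.
Qed.

Section Bound.
Variables (n : nat) (y : 'rV[R]_d).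
Let ker (x : 'rV[R]_d) := fejer_kernel n (y - x).
Let cker : continuous ker. Proof. exact: continuous_fejer_kernel. Qed.

Let integral_ker : cube_integral ker = 1.
Proof.
have := fejer_mean_cis n 0 y; rewrite card_box_diff0 phase0 cis0 mulr1.
rewrite mulVf ?pnatr_eq0 -?lt0n ?card_box_gt0// => /(congr1 (@complex.Re R)) /= <-.
by congr cube_integral; apply/funext => x; rewrite phase0 cos0 sin0 !mul1r mul0r subr0.
Qed.

Let ccos0 (i : 'I_d) : continuous (fun x : 'rV[R]_d => cos (2 * pi * (x 0 i - y 0 i))).
Proof.
move=> x; apply: continuous_comp; last exact: continuous_cos.
apply: continuous_scale; apply: continuous_sub; last exact: cst_continuous.
exact: coord_continuous.
Qed.

Let ccos (i : 'I_d) : continuous (fun x : 'rV[R]_d => 1 - cos (2 * pi * (x 0 i - y 0 i))).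
Proof. by apply: continuous_sub => //; exact: cst_continuous. Qed.

Let integral_cos_ker (i : 'I_d) :
  cube_integral (fun x => (1 - cos (2 * pi * (x 0 i - y 0 i))) * ker x) <= n.+1%:R^-1.
Proof.
have cp : ccontinuous (fun x : 'rV[R]_d => cis (phase (delta_mx 0 i) x) * (ker x)%:C%C).
  apply: ccontinuousM; first exact: ccontinuous_cis_phase.
  by split => //; exact: cst_continuous.
have : cube_integral (fun x => cos (2 * pi * (x 0 i - y 0 i)) * ker x) =
    @fejer_weight R d n * #|[set p : 'rV['I_n.+1]_d * 'rV['I_n.+1]_d |
      box_freq p.1 - box_freq p.2 == delta_mx 0 i]%SET|%:R.
  set D := #|_|.
  have <- : complex.Re (cis (- phase (delta_mx 0 i) y) *
      fejer_mean n (fun x => cis (phase (delta_mx 0 i) x)) y) = @fejer_weight R d n * D%:R.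
    by rewrite fejer_mean_cis mulrCA [cis _ * cis _]mulrC cis_mulN mulr1.
  rewrite /fejer_mean -ccube_integralZ //; congr cube_integral.
  apply/funext => x; rewrite mulrA -cisD Re_mulc /= mulr0 subr0 !phase_delta.
  by congr (cos _ * _); ring.
move=> Ecos; under eq_fun do rewrite mulrBl mul1r -mulN1r.
have ckcos : continuous (fun x : 'rV[R]_d => cos (2 * pi * (x 0 i - y 0 i)) * ker x).
  exact: continuous_mul.
rewrite cube_integralD//; last exact: continuous_scale.
rewrite integral_ker cube_integralZ// Ecos mulN1r lerBlDr -lerBlDl.
exact: card_box_diff_delta.
Qed.

(** The kernel is nonnegative with integral 1, so the pointwise estimate can be integrated against
    it; each cosine term then costs at most 1/(n+1). *)
Lemma fejer_real_bound (F : 'rV[R]_d -> R) (e C : R) : continuous F -> 0 <= C ->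
  (forall x, unit_cube x ->
    `|F x - F y| <= e + C * \sum_i (1 - cos (2 * pi * (x 0 i - y 0 i)))) ->
  `|cube_integral (fun x => F x * ker x) - F y| <= e + C * (d%:R / n.+1%:R).
Proof.
move=> cF C0 FC.
have cFk : continuous (fun x => F x * ker x) by exact: continuous_mul.
have cck i : continuous (fun x : 'rV[R]_d => (1 - cos (2 * pi * (x 0 i - y 0 i))) * ker x).
  exact: continuous_mul.
pose G x := e * ker x + C * \sum_i ((1 - cos (2 * pi * (x 0 i - y 0 i))) * ker x).
have cG : continuous G.
  by apply: continuous_add; apply: continuous_scale => //; exact: continuous_bigsum.
have cys : continuous (fun x => F y * ker x) by exact: continuous_scale.
have intG : cube_integral G <= e + C * (d%:R / n.+1%:R).
  rewrite cube_integralD; [|exact: continuous_scale|]; last first.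
    by apply: continuous_scale; exact: continuous_bigsum.
  rewrite (cube_integralZ _ cker) integral_ker mulr1 lerD2l.
  rewrite cube_integralZ; last exact: continuous_bigsum.
  rewrite ler_wpM2l// cube_integral_bigsum//.
  apply: (@le_trans _ _ (\sum_(i < d) n.+1%:R^-1)).
    by apply: ler_sum => i _; exact: integral_cos_ker.
  by rewrite sumr_const card_ord mulr_natl.
have intFy : cube_integral (fun x => F y * ker x) = F y.
  by rewrite (cube_integralZ _ cker) integral_ker mulr1.
have bnd x : unit_cube x -> `|F x * ker x - F y * ker x| <= G x.
  move=> cx; have k0 : 0 <= ker x by exact: fejer_kernel_ge0.
  have -> : G x = (e + C * \sum_i (1 - cos (2 * pi * (x 0 i - y 0 i)))) * ker x.
    by rewrite mulrDl -mulrA mulr_suml.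
  by rewrite -mulrBl normrM (ger0_norm k0) ler_wpM2r ?FC.
rewrite ler_norml; apply/andP; split.
- rewrite lerBrDr addrC lerBlDr -[leLHS]intFy.
  apply: (@le_trans _ _ (cube_integral (fun x => F x * ker x) + cube_integral G)); last first.
    by rewrite lerD2l.
  rewrite -cube_integralD//; apply: le_cube_integral => //; first exact: continuous_add.
  by move=> x /bnd; rewrite ler_distl; lra.
- rewrite lerBlDr addrC -[X in X + _]intFy.
  apply: (@le_trans _ _ (cube_integral (fun x => F y * ker x) + cube_integral G)); last first.
    by rewrite lerD2l.
  rewrite -cube_integralD//; apply: le_cube_integral => //; first exact: continuous_add.
  by move=> x /bnd; rewrite ler_distl; lra.
Qed.

End Bound.

Lemma fejer_meanRI n (f : 'rV[R]_d -> R[i]) y : fejer_mean n f y =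
  Complex (cube_integral (fun x => complex.Re (f x) * fejer_kernel n (y - x)))
          (cube_integral (fun x => complex.Im (f x) * fejer_kernel n (y - x))).
Proof.
rewrite /fejer_mean /ccube_integral; congr Complex; congr cube_integral; apply/funext => x.
  by rewrite Re_mulc /= mulr0 subr0.
by rewrite Im_mulc /= mulr0 add0r.
Qed.

Lemma fejer_real_cvg (F : 'rV[R]_d -> R) y (e : R) :
  continuous F -> (forall x j, F (x + delta_mx 0 j) = F x) -> 0 < e ->
  \forall n \near \oo,
    `|cube_integral (fun x => F x * fejer_kernel n (y - x)) - F y| <= e.
Proof.
move=> cF pF e0; have e20 : 0 < e / 2 by rewrite divr_gt0.
have [C C0 HC] := korovkin_bound y cF pF e20.
have D0 : 0 < C * d%:R + 1 by rewrite ltr_wpDl// mulr_ge0.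
near=> n.
apply: (le_trans (fejer_real_bound n cF C0 HC)).
rewrite [leRHS]splitr lerD2l mulrA.
have : n.+1%:R^-1 < e / 2 / (C * d%:R + 1) :> R.
  near: n; have p : 0 < e / 2 / (C * d%:R + 1) by rewrite divr_gt0.
  exact: (near_infty_natSinv_lt (PosNum p)).
rewrite ltr_pdivlMr// => /ltW H; apply: le_trans H.
by rewrite mulrC ler_wpM2l ?invr_ge0// lerDl.
Unshelve. all: end_near. Qed.

Lemma fejer_mean_cvg (f : 'rV[R]_d -> R[i]) y :
  ccontinuous f -> (forall x j, f (x + delta_mx 0 j) = f x) ->
  (fun n => normc (fejer_mean n f y - f y)) @ \oo --> (0 : R).
Proof.
move=> [cR cI] pf; apply/cvgrPdist_le => e e0; have e20 : 0 < e / 2 by rewrite divr_gt0.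
near=> n; rewrite sub0r normrN ger0_norm ?normc_ge0//.
apply: le_trans (normc_le_ReIm _) _; rewrite [leRHS]splitr fejer_meanRI.
have -> : f y = Complex (complex.Re (f y)) (complex.Im (f y)) by rewrite complex_eta.
apply: lerD => /=; near: n; apply: fejer_real_cvg => // x j; by rewrite pf.
Unshelve. all: end_near. Qed.

(* Applying a finite combination of point evaluations to the Fejer means, which
   are trigonometric polynomials with damped Fourier coefficients, avoids any
   pointwise Fourier inversion. *)
Lemma point_functional_le (f : 'rV[R]_d -> R[i]) (s : seq (R[i] * 'rV[R]_d)) (B : R) :
  ccontinuous f -> (forall x j, f (x + delta_mx 0 j) = f x) ->
  (forall K : seq 'rV[int]_d, uniq K ->
     \sum_(k <- K) normc (fourier_coef f k) *
       normc (\sum_(p <- s) p.1 * cis (phase k p.2)) <= B) ->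
  normc (\sum_(p <- s) p.1 * f p.2) <= B.
Proof.
move=> cf pf HB.
have Tfejer n : normc (\sum_(p <- s) p.1 * fejer_mean n f p.2) <= B.
  pose T k := \sum_(p <- s) p.1 * cis (phase k p.2).
  have -> : \sum_(p <- s) p.1 * fejer_mean n f p.2 = (@fejer_weight R d n)%:C%C *
      \sum_(j : 'rV['I_n.+1]_d) \sum_(l : 'rV['I_n.+1]_d)
        fourier_coef f (box_freq j - box_freq l) * T (box_freq j - box_freq l).
    under eq_bigr do rewrite fejer_meanE// mulrCA.
    rewrite -mulr_sumr; congr (_ * _).
    under eq_bigr do rewrite mulr_sumr.
    rewrite exchange_big; apply: eq_bigr => j _.
    under eq_bigr do rewrite mulr_sumr.
    rewrite exchange_big; apply: eq_bigr => l _.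
    by rewrite mulr_sumr; apply: eq_bigr => p _; rewrite mulrCA.
  rewrite ComplexField.Normc.normcM normc_real gtr0_norm ?fejer_weight_gt0//.
  rewrite /fejer_weight ler_pdivrMl ?ltr0n ?card_box_gt0//.
  apply: (@le_trans _ _ (\sum_(j : 'rV['I_n.+1]_d) B)); last first.
    by rewrite sumr_const mulr_natl.
  apply: (le_trans (normc_sum _ _ _)); apply: ler_sum => j _.
  apply: (le_trans (normc_sum _ _ _)).
  (* For fixed j the frequencies j - l are pairwise distinct, so each inner sum is at most B, and
     the weight averages these sums over j. *)
  have /HB : uniq [seq box_freq j - box_freq l | l <- enum {: 'rV['I_n.+1]_d}].
    by rewrite map_inj_uniq ?enum_uniq// => l m /addrI /oppr_inj /box_freq_inj.
  rewrite big_map big_enum /=; apply: le_trans.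
  by apply: ler_sum => l _; rewrite ComplexField.Normc.normcM.
have err0 : (fun n => \sum_(p <- s) normc p.1 * normc (fejer_mean n f p.2 - f p.2))
    @ \oo --> (0 : R).
  elim: s {HB Tfejer} => [|p s IH].
    by under eq_fun do rewrite big_nil; exact: cvg_cst.
  under eq_fun do rewrite big_cons.
  have := cvgD (cvgM (@cvg_cst _ (normc p.1) _ \oo _) (fejer_mean_cvg p.2 cf pf)) IH.
  by rewrite mulr0 addr0; apply.
apply/ler_addgt0Pr => e e0.
have /cvgrPdist_le /(_ _ e0) near_err := err0.
near \oo => n.
have near_err_n : \sum_(p <- s) normc p.1 * normc (fejer_mean n f p.2 - f p.2) <= e.
  have : `|0 - \sum_(p <- s) normc p.1 * normc (fejer_mean n f p.2 - f p.2)| <= e.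
    by near: n; exact: near_err.
  rewrite sub0r normrN ger0_norm// sumr_ge0// => p _; exact: mulr_ge0 (normc_ge0 _) (normc_ge0 _).
have -> : \sum_(p <- s) p.1 * f p.2 = \sum_(p <- s) p.1 * fejer_mean n f p.2 -
    \sum_(p <- s) p.1 * (fejer_mean n f p.2 - f p.2).
  by rewrite -sumrB; apply: eq_bigr => p _; rewrite -mulrBr opprB addrCA subrr addr0.
apply: (le_trans (le_normcD _ _)); rewrite lerD ?Tfejer// normcN.
apply: le_trans near_err_n; apply: (le_trans (normc_sum _ _ _)).
by apply: ler_sum => p _; rewrite ComplexField.Normc.normcM.
Unshelve. all: end_near. Qed.

End FejerConvergence.

(** * Exponential sums over rank-1 lattices *)

Section CharacterSums.
Context {R : realType}.

(** With r the remainder of a modulo n, the real part is 1 - 2 sin(t)^2 for t = pi r / n. If 0 < r <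
    n, then t lies in (0, pi) and the sine does not vanish. *)
Lemma cis_eq1_dvd (n : nat) (a : int) : (0 < n)%N ->
  cis (2 * pi * (a%:~R / n%:R) : R) = 1 -> (n %| a)%Z.
Proof.
move=> n0; have nR : (0 : R) < n%:R by rewrite ltr0n.
have nZ : n%:Z != 0 by rewrite -lt0n.
have nE : (n%:Z)%:~R = n%:R :> R by [].
rewrite {1}(divz_eq a n) intrD intrM nE [(_ + _) / _]mulrDl mulfK ?gt_eqF// mulrDr cisD cis_int mul1r.
set r := (a %% n)%Z => cr1; apply/dvdz_mod0P/eqP; rewrite -/r; apply: contraPT cr1 => rn0.
have r0 : 0 < r by rewrite lt_neqAle eq_sym rn0 modz_ge0.
have rn : r < n by rewrite ltz_pmod.
pose t : R := pi * (r%:~R / n%:R).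
have -> : 2 * pi * (r%:~R / n%:R) = t *+ 2 :> R by rewrite /t mulr2n; ring.
have st : 0 < sin t.
  apply: sin_gt0_pi; rewrite mulr_gt0 ?pi_gt0 ?divr_gt0 ?ltr0z//=.
  by rewrite gtr_pMr ?pi_gt0// ltr_pdivrMr// mul1r (ltr_int R r n%:Z).
move=> /(congr1 (@complex.Re R)) /=; rewrite cos_mulr2n cos2sin2 => E.
have : sin t ^+ 2 = 0 by lra.
by apply/eqP; rewrite expf_neq0// gt_eqF.
Qed.

Lemma sum_cis (n : nat) (a : int) : (0 < n)%N ->
  \sum_(i < n) cis (2 * pi * (i%:R * a%:~R / n%:R) : R) = ((n %| a)%Z * n)%:R.
Proof.
move=> n0; have nR : (0 : R) < n%:R by rewrite ltr0n.
pose z : R[i] := cis (2 * pi * (a%:~R / n%:R)).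
have zi (i : nat) : cis (2 * pi * (i%:R * a%:~R / n%:R) : R) = z ^+ i.
  by rewrite -cis_nat; congr cis; ring.
under eq_bigr do rewrite zi.
have [/dvdzP[q aE]|na] := boolP (n %| a)%Z.
  have nE : (n%:Z)%:~R = n%:R :> R by [].
  have -> : z = 1 by rewrite /z aE intrM nE mulfK ?gt_eqF// cis_int.
  by under eq_bigr do rewrite expr1n; rewrite sumr_const card_ord mul1n.
have z1 : z - 1 != 0.
  by rewrite subr_eq0; apply: contraNneq na => z1; exact: cis_eq1_dvd n0 z1.
apply/eqP; rewrite mul0n -(mulrI_eq0 _ (lregP z1)) -subrX1 -zi.
have -> : n%:R * a%:~R / n%:R = a%:~R :> R by field; rewrite gt_eqF.
by rewrite cis_int subrr.
Qed.

End CharacterSums.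

Lemma count_le1 (T : eqType) (a : pred T) (s : seq T) : uniq s ->
  {in s &, forall x y, a x -> a y -> x = y} -> (count a s <= 1)%N.
Proof.
move=> us aE; rewrite -size_filter.
have : uniq (seq.filter a s) by exact: filter_uniq.
have : {in seq.filter a s &, forall x y, x = y}.
  by move=> x y; rewrite !mem_filter => /andP[ax xs] /andP[ay ys]; exact: aE.
case: (seq.filter a s) => [|x [|y t]]// /(_ x y).
by rewrite !inE !eqxx orbT => /(_ isT isT) -> /=; rewrite inE eqxx.
Qed.

Section LatticeRule.
Context {R : realType} {d : nat}.
Variables (A : {fset 'rV[int]_d}) (ls : seq (lattice d)).
Hypothesis ls_pos : forall l, l \in ls -> (0 < l.1)%N.
Hypothesis covered : forall k, k \in A -> (1 <= xi A ls k)%N.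
Implicit Types (k h : 'rV[int]_d) (x : 'rV[R]_d) (l : lattice d).

(** The condition under which lattice l reads the character of h as a full contribution to the
    coefficient at k. *)
Definition hits l h k : bool :=
  aliasing_free A l k && (dot h l.2 == dot k l.2 %[mod l.1])%Z.

Lemma cis_phase_lattice_point k l (i : nat) :
  cis (phase k (lattice_point R l i)) =
  cis (2 * pi * (i%:R * (dot k l.2)%:~R / l.1%:R) : R).
Proof.
pose m := \sum_(j < d) k 0 j * Num.floor (i%:R * (l.2 0 j)%:~R / l.1%:R : R).
rewrite (_ : 2 * pi * (i%:R * (dot k l.2)%:~R / l.1%:R) =
  phase k (lattice_point R l i) + 2 * pi * m%:~R); first by rewrite cisD cis_int mulr1.
rewrite /phase -mulrDr; congr (_ * _).
rewrite /dot /m !rmorph_sum mulr_sumr mulr_suml -big_split; apply: eq_bigr => j _ /=.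
by rewrite mxE !intrM /=; ring.
Qed.

Lemma dot_subl h k (g : 'rV[int]_d) : dot h g - dot k g = dot (h - k) g.
Proof. by rewrite /dot -sumrB; apply: eq_bigr => j _; rewrite !mxE mulrBl. Qed.

Lemma lattice_coef_cis h k :
  lattice_coef A ls (fun y : 'rV[R]_d => cis (phase h y)) k =
  (xi A ls k)%:R^-1 * (\sum_(l <- ls) hits l h k)%:R.
Proof.
congr (_ * _); rewrite natr_sum [LHS]big_seq [RHS]big_seq; apply: eq_bigr => l /ls_pos l0.
under eq_bigr => i _.
  rewrite -phaseNl !cis_phase_lattice_point -cisD -mulrDr -mulrDl -mulrDr -intrD.
over.
rewrite sum_cis// /hits.
have -> : dot (- k) l.2 = - dot k l.2.
  by rewrite /dot -sumrN; apply: eq_bigr => j _; rewrite mxE mulNr.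
rewrite eqz_mod_dvd; case: (aliasing_free A l k); last by rewrite !mul0r.
case: (_ %| _)%Z; last by rewrite mul0n mulr0.
by rewrite mul1n mul1r mulVf// pnatr_eq0 -lt0n.
Qed.

Lemma hits_self l h k : h \in A -> hits l h k = aliasing_free A l k && (h == k).
Proof.
move=> hA; rewrite /hits; case: (eqVneq h k) => [->|hk]; first by rewrite eqxx.
rewrite andbF; apply/negP => /andP[/andP[_ /hasPn/(_ h hA)] /[swap] hE].
by rewrite hk hE.
Qed.

Lemma A_mult_cis_in h x : h \in A ->
  A_mult A ls (fun y => cis (phase h y)) x = cis (phase h x).
Proof.
move=> hA; rewrite /A_mult (bigD1_seq h) ?fset_uniq//= big1_seq ?addr0 => [|k /andP[kh _]].
  rewrite lattice_coef_cis; under eq_bigr do rewrite hits_self// eqxx andbT.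
  rewrite mulVf ?mul1r// pnatr_eq0 -lt0n; exact: covered.
rewrite lattice_coef_cis; under eq_bigr do rewrite hits_self// eq_sym (negbTE kh) andbF.
by rewrite big1// mulr0 mul0r.
Qed.

Lemma count_hits l h : (count (hits l h) A <= 1)%N.
Proof.
apply: count_le1 => [|k m kA mA]; first exact: fset_uniq.
rewrite /hits => /andP[/andP[_ /hasPn/(_ m mA) free] /eqP hk] /andP[_ /eqP hm].
by apply: contraNeq free => mk; rewrite eq_sym mk -hm hk eqxx.
Qed.

(** Dropping the factor 1/[xi] <= 1 leaves the number of pairs (k, l) with [hits l h k]; exchanging
    the sums, each lattice accounts for at most one such k. *)
Lemma normc_A_mult_cis h x :
  normc (A_mult A ls (fun y => cis (phase h y)) x) <= (size ls)%:R.
Proof.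
apply: (le_trans (normc_sum _ _ _)).
apply: (@le_trans _ _ (\sum_(k <- A) (\sum_(l <- ls) hits l h k)%:R)).
  rewrite big_seq [leRHS]big_seq; apply: ler_sum => k kA.
  rewrite ComplexField.Normc.normcM normc_cis mulr1 lattice_coef_cis.
  rewrite ComplexField.Normc.normcM ComplexField.Normc.normcV.
  have nat_normc (m : nat) : normc (m%:R : R[i]) = m%:R.
    by rewrite -(rmorph_nat (real_complex R)) normc_real normr_nat.
  rewrite !nat_normc ler_piMl// invf_le1 ?ler1n ?ltr0n; exact: covered.
rewrite -natr_sum ler_nat exchange_big /= -sum1_size.
apply: leq_sum => l _; rewrite -[leqLHS]big_mkcond sum1_count; exact: count_hits.
Qed.

End LatticeRule.

(** * Finite combinations of point evaluations *)

Section PointFunctionals.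
Context {R : realType} {d : nat}.
Local Notation V := 'rV[R]_d.

Definition point_functional (T : (V -> R[i]) -> R[i]) : Prop :=
  exists s : seq (R[i] * V), forall f, T f = \sum_(p <- s) p.1 * f p.2.

Lemma point_functional_eval x : point_functional (fun f => f x).
Proof. by exists [:: (1, x)] => f; rewrite big_seq1 mul1r. Qed.

Lemma point_functional_scale (c : R[i]) T :
  point_functional T -> point_functional (fun f => c * T f).
Proof.
move=> [s Ts]; exists [seq (c * p.1, p.2) | p <- s] => f.
by rewrite Ts mulr_sumr big_map; apply: eq_bigr => p _; rewrite mulrA.
Qed.

Lemma point_functional_add T U : point_functional T -> point_functional U ->
  point_functional (fun f => T f + U f).
Proof. by move=> [s Ts] [t Ut]; exists (s ++ t) => f; rewrite big_cat Ts Ut. Qed.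

Lemma point_functional_sum I (r : seq I) (T : I -> (V -> R[i]) -> R[i]) :
  (forall i, point_functional (T i)) ->
  point_functional (fun f => \sum_(i <- r) T i f).
Proof.
move=> HT; elim: r => [|i r IH].
  by exists [::] => f; rewrite !big_nil.
by under eq_fun do rewrite big_cons; exact: point_functional_add.
Qed.

Lemma point_functional_A_mult A (ls : seq (lattice d)) x :
  point_functional (fun f => f x - A_mult A ls f x).
Proof.
apply: point_functional_add; first exact: point_functional_eval.
under eq_fun do rewrite -mulN1r; apply: point_functional_scale.
apply: point_functional_sum => k.
under eq_fun do rewrite mulrC; apply: point_functional_scale.
apply: point_functional_scale; apply: point_functional_sum => l.
apply: point_functional_scale; apply: point_functional_sum => i.
under eq_fun do rewrite mulrC; apply: point_functional_scale.
exact: point_functional_eval.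
Qed.

End PointFunctionals.

(** * Sums over the Korobov weights *)

Section Zeta.
Context {R : realType}.
Implicit Types s : R.

(** Dyadic condensation: the block with 2^m <= i+1 < 2^(m+1) has 2^m terms, each at most 2^(-ms), so
    it contributes at most q^m with q = 2^(1-s) < 1. The bound ensures that the limit defining
    [zeta] is a genuine one. *)
Lemma zeta_partial_bound s (m : nat) : 1 < s ->
  \sum_(0 <= i < (2 ^ m).-1) i.+1%:R `^ (- s) <= (1 - 2 `^ (1 - s))^-1.
Proof.
move=> s1; set q : R := 2 `^ (1 - s).
have q0 : 0 < q by rewrite powR_gt0.
have q1 : q < 1.
  rewrite /q -opprB powRN invf_lt1 ?powR_gt0// -{1}(powRr0 2) /powR (gt_eqF (ltr0n R 2)).
  by rewrite mul0r expR0 expR_gt1 mulr_gt0 ?subr_gt0// ln_gt0// ltr1n.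
apply: (@le_trans _ _ (\sum_(0 <= j < m) q ^+ j)).
  elim: m => [|m IH]; first by rewrite !big_geq.
  have pm : (0 < 2 ^ m)%N by rewrite expn_gt0.
  rewrite big_nat_recr//= (@big_cat_nat _ _ _ (2 ^ m).-1) //=; last first.
    by rewrite expnS mul2n -addnn; lia.
  apply: lerD => //.
  have pmR : (0 : R) < 2 ^+ m by rewrite exprn_gt0.
  apply: (@le_trans _ _ (\sum_((2 ^ m).-1 <= i < (2 ^ m.+1).-1) (2 ^+ m) `^ (- s))).
    rewrite big_nat [leRHS]big_nat; apply: ler_sum => i /andP[mi _].
    rewrite !powRN lef_pV2 ?posrE ?powR_gt0//.
    rewrite ge0_ler_powR ?nnegrE ?(ltW pmR)//; first by rewrite ltW// (lt_trans _ s1).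
    by rewrite -natrX ler_nat; lia.
  rewrite sumr_const_nat (_ : _ - _ = 2 ^ m)%N; last first.
    by rewrite expnS mul2n -addnn; lia.
  rewrite -[_ *+ (2 ^ m)]mulr_natl natrX -[X in X * _]powRr1 ?(ltW pmR)// -powRD ?(gt_eqF pmR) ?implybT//.
  have -> : q ^+ m = (2 ^+ m) `^ (1 - s).
    by rewrite -(@powR_mulrn R q m (ltW q0)) -(@powR_mulrn R 2 m (ler0n R 2)) [LHS]powRAC.
  exact: lexx.
have -> : \sum_(0 <= j < m) q ^+ j = series (geometric 1 q) m.
  by rewrite /series /=; apply: eq_bigr => i _; rewrite mul1r.
rewrite geometric_seriesE ?lt_eqF//= mul1r ler_pdivrMr ?subr_gt0//.
by rewrite mulVf ?gt_eqF ?subr_gt0// gerBl exprn_ge0// ltW.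
Qed.

Lemma zeta_partial s (n : nat) : 1 < s -> \sum_(i < n) i.+1%:R `^ (- s) <= zeta s.
Proof.
move=> s1; rewrite -(big_mkord xpredT (fun i => i.+1%:R `^ (- s))).
have nd : nondecreasing_seq (series (fun n : nat => n.+1%:R `^ (- s))).
  by apply: nondecreasing_series => i _ _; exact: powR_ge0.
apply: (nondecreasing_cvgn_le nd); apply: nondecreasing_is_cvgn => //.
exists (1 - 2 `^ (1 - s))^-1 => _ [m _ <-].
apply: le_trans (zeta_partial_bound m s1); apply: nd.
by have := ltn_expl m (ltnSn 1); lia.
Qed.

Lemma zeta_gt0 s : 1 < s -> 0 < zeta s.
Proof.
move=> s1; apply: lt_le_trans (zeta_partial 1 s1).
by rewrite big_ord1 powR_gt0.
Qed.

End Zeta.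

Lemma powR_prod (R : realType) (I : Type) (r : seq I) (P : pred I) (f : I -> R) (e : R) :
  (forall i, 0 <= f i) ->
  (\prod_(i <- r | P i) f i) `^ e = \prod_(i <- r | P i) (f i `^ e).
Proof.
move=> f0; elim: r => [|i r IH]; first by rewrite !big_nil powR1.
by rewrite !big_cons; case: (P i) => //; rewrite powRM ?IH// prodr_ge0.
Qed.

Section KorobovSums.
Context {R : realType} {d : nat}.
Variables (gamma : {fset nat} -> R).
Hypothesis gamma0 : forall u, 0 <= gamma u.
Implicit Types (k : 'rV[int]_d) (u : {set 'I_d}) (F : seq 'rV[int]_d).

(* The reciprocal of [korobov_r], with value 0 at infinite [korobov_r]. *)
Definition korobov_rho (alpha : R) k : R :=
  gamma (labels (supp k)) * \prod_(j in supp k) (`|k 0 j|%:~R `^ (- alpha)).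

Lemma korobov_rho_ge0 alpha k : 0 <= korobov_rho alpha k.
Proof. by rewrite mulr_ge0// prodr_ge0// => j _; exact: powR_ge0. Qed.

Lemma korobov_rho_powR alpha lambda k : korobov_rho alpha k `^ lambda =
  gamma (labels (supp k)) `^ lambda *
  \prod_(j in supp k) (`|k 0 j|%:~R `^ (- (alpha * lambda))).
Proof.
rewrite /korobov_rho powRM//; last by apply: prodr_ge0 => j _; exact: powR_ge0.
rewrite powR_prod; last by move=> j; exact: powR_ge0.
by congr (_ * _); apply: eq_bigr => j _; rewrite -powRrM mulNr.
Qed.

Section Box.
Variable n : nat.

Let T := option (bool * 'I_n).

(** Codes the integers of [-n, n] with zero apart and the sign separate, so that the sum over
    nonzero values is two partial zeta sums. *)
Definition box_int (o : T) : int :=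
  if o is Some (b, i) then (if b then i.+1%:Z else - i.+1%:Z) else 0.

Definition int_box (z : int) : T :=
  if z == 0 then None else omap (pair (0 < z)) (insub `|z|.-1).

Lemma int_boxK z : (`|z| <= n)%N -> box_int (int_box z) = z.
Proof.
move=> zn; rewrite /int_box; case: eqP => [->//|/eqP z0].
have zn' : (`|z|.-1 < n)%N by move: z0 zn; rewrite -absz_gt0; lia.
rewrite insubT /= prednK ?absz_gt0//; case: ltP => z_ge; lia.
Qed.

Lemma sum_box_int (s : R) : 1 < s ->
  \sum_(o : T) (if o == None then 0 else `|box_int o|%:~R `^ (- s)) <= 2 * zeta s.
Proof.
move=> s1; rewrite (bigD1 None) //= add0r.
rewrite (reindex_omap Some (fun o : T => o)); last by case.
rewrite (eq_bigl xpredT) => [|[b i]]; last by rewrite eqxx.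
rewrite (eq_bigr (fun p : bool * 'I_n => `|box_int (Some (p.1, p.2))|%:~R `^ (- s)));
  last by case.
rewrite -(pair_bigA _ (fun b i => `|box_int (Some (b, i))|%:~R `^ (- s))) /=.
rewrite big_bool /= mulr_natl mulr2n; apply: lerD.
  by apply: zeta_partial.
by under eq_bigr do rewrite normrN; exact: zeta_partial.
Qed.

End Box.
Definition korobov_S (alpha lambda : R) : R := \sum_(u : {set 'I_d})
  gamma (labels u) `^ lambda * (2 * zeta (alpha * lambda)) ^+ #|u|.

(** F lies in a box [-n, n]^d. Each k is charged to its support u, and for fixed u the sum over the
    box is a product over coordinates, with a factor at most 2 [zeta] for j in u and a factor 1 for
    the others. *)
Lemma sum_rho_powR_le (alpha lambda : R) F : 1 < alpha * lambda -> uniq F ->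
  \sum_(k <- F) korobov_rho alpha k `^ lambda <= korobov_S alpha lambda.
Proof.
move=> s1 uF; set s := alpha * lambda in s1 *.
pose n := \max_(k <- F) \max_j absz (k 0%R j).
pose T := option (bool * 'I_n).
have kn k j : k \in F -> (absz (k 0%R j) <= n)%N.
  move=> kF.
  pose N (k : 'rV[int]_d) := (\max_j absz (k 0%R j))%N.
  apply: (@leq_trans (N k)); first exact: (@leq_bigmax _ (fun j => absz (k 0%R j)) j).
  exact: (@leq_bigmax_seq _ F xpredT N k kF isT).
pose tok (g : {ffun 'I_d -> T}) : 'rV[int]_d := \row_j box_int (g j).
pose enc k : {ffun 'I_d -> T} := [ffun j => int_box n (k 0 j)].
have encK k : k \in F -> tok (enc k) = k.
  by move=> kF; apply/rowP => j; rewrite mxE ffunE int_boxK// kn.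
(* The product of [phi u] over j vanishes unless u is exactly the support: coordinates in u must be
   nonzero, those outside u zero. *)
pose phi u (j : 'I_d) (o : T) : R := if j \in u then
  (if o == None then 0 else `|box_int o|%:~R `^ (- s)) else (o == None)%:R.
have phi0 u j o : 0 <= phi u j o by rewrite /phi; case: ifP => // _; case: ifP => // _; exact: powR_ge0.
have bint0 (o : T) : (box_int o == 0) = (o == None).
  by case: o => [[[] i]|]//=; rewrite oppr_eq0.
have w_le g : korobov_rho alpha (tok g) `^ lambda <=
    \sum_(u : {set 'I_d}) gamma (labels u) `^ lambda * \prod_j phi u j (g j).
  rewrite korobov_rho_powR (bigD1 (supp (tok g)))//= -[leLHS]addr0 lerD//; last first.
    by apply: sumr_ge0 => u _; rewrite mulr_ge0 ?powR_ge0// prodr_ge0.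
  rewrite big_mkcond /=; apply: ler_wpM2l; first exact: powR_ge0.
  apply: ler_prod => j _; rewrite /phi; have := bint0 (g j); rewrite !inE !mxE.
  by case: (g j == None) => -> /=; rewrite ?powR_ge0 ?lexx// ?ler01.
have -> : \sum_(k <- F) korobov_rho alpha k `^ lambda =
    \sum_(g <- map enc F) korobov_rho alpha (tok g) `^ lambda.
  rewrite big_map; apply: eq_big_seq => k kF.
  by congr (korobov_rho _ _ `^ _); exact/esym/encK.
have ue : uniq (map enc F).
  by rewrite map_inj_in_uniq// => k h /encK {2}<- /encK {2}<- ->.
rewrite big_uniq//=.
apply: (@le_trans _ _ (\sum_g korobov_rho alpha (tok g) `^ lambda)).
  rewrite big_mkcond; apply: ler_sum => g _; case: ifP => // _; exact: powR_ge0.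
apply: (le_trans (ler_sum _ (fun g _ => w_le g))).
rewrite exchange_big /=; apply: ler_sum => u _.
rewrite -mulr_sumr ler_wpM2l ?powR_ge0//.
rewrite -(bigA_distr_bigA (phi u)) -prodr_const [leRHS]big_mkcond /=.
apply: ler_prod => j _; rewrite sumr_ge0//= /phi.
case: (j \in u); first exact: sum_box_int.
by rewrite (bigD1 None)//= big1 ?addr0// => o /negbTE ->.
Qed.

End KorobovSums.

Section KorobovTail.
Context {R : realType} {d : nat}.
Variables (alpha lambda M : R) (gamma : {fset nat} -> R).
Hypotheses (gamma0 : forall u, 0 <= gamma u) (gamma_empty : gamma fset0 = 1).
Hypotheses (alpha_gt : 1 / 2 < alpha) (lambda_gt : 1 / alpha < lambda).
Hypotheses (lambda_lt2 : lambda < 2) (M1 : 1 <= M).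
Implicit Types (k : 'rV[int]_d) (F : seq 'rV[int]_d).
Local Notation rho := (korobov_rho gamma alpha).
Local Notation S := (@korobov_S R d gamma alpha lambda).

Lemma korobov_alpha_gt0 : 0 < alpha.
Proof. by apply: lt_trans alpha_gt; rewrite divr_gt0. Qed.

Lemma korobov_lambda_gt0 : 0 < lambda.
Proof. by apply: lt_trans lambda_gt; rewrite divr_gt0 ?korobov_alpha_gt0. Qed.

Lemma korobov_alpha_lambda : 1 < alpha * lambda.
Proof. by have := lambda_gt; rewrite ltr_pdivrMr ?korobov_alpha_gt0 1?mulrC. Qed.

Lemma korobov_S_ge1 : 1 <= S.
Proof.
rewrite /korobov_S (bigD1 finset.set0)//= cards0 expr0 mulr1.
have -> : labels (finset.set0 : {set 'I_d}) = fset0.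
  by apply/fsetP => i; rewrite !inE; apply/imfsetP => -[j]; rewrite inE.
rewrite gamma_empty powR1 lerDl sumr_ge0// => u _.
by rewrite mulr_ge0 ?powR_ge0// exprn_ge0// mulr_ge0// ltW// zeta_gt0// korobov_alpha_lambda.
Qed.

Lemma korobov_rho_eq0 k : (rho k == 0) = (gamma (labels (supp k)) == 0).
Proof.
rewrite mulf_eq0 orb_idr// => /eqP /eqP; rewrite prodf_seq_eq0 => /hasP[j _ /andP[]].
by rewrite inE => kj; rewrite powR_eq0 intr_eq0 normr_eq0 (negbTE kj).
Qed.

Lemma korobov_rE k : gamma (labels (supp k)) != 0 ->
  korobov_r alpha gamma k = ((rho k)^-1)%:E.
Proof.
move=> g0; rewrite /korobov_r (negbTE g0) invfM -prodfV; congr (_ * _)%:E.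
by apply: eq_bigr => j _; rewrite powRN invrK.
Qed.

(** When the weight vanishes both sides fail, since [korobov_r] is infinite and [rho] is 0.
    Otherwise the two are reciprocal. *)
Lemma in_korobov_set k : korobov_set alpha gamma M k <-> M^-1 <= rho k.
Proof.
have M0 : 0 < M by exact: lt_le_trans M1.
rewrite /korobov_set /=; have [g0|g0] := eqVneq (gamma (labels (supp k))) 0.
  rewrite /korobov_r g0 eqxx leye_eq; split=> //.
  have /eqP -> : rho k == 0 by rewrite korobov_rho_eq0 g0.
  by rewrite leNgt invr_gt0 M0.
have r0 : 0 < rho k by rewrite lt_neqAle eq_sym korobov_rho_eq0 g0 korobov_rho_ge0.
by rewrite korobov_rE// lee_fin invf_ple ?posrE.
Qed.

(** A Markov-type count: (M rho)^lambda >= 1 on the set. *)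
Lemma card_korobov_le F : uniq F -> (forall k, k \in F -> korobov_set alpha gamma M k) ->
  (size F)%:R <= M `^ lambda * S.
Proof.
move=> uF FM; have M0 : 0 < M by exact: lt_le_trans M1.
have := sum_rho_powR_le gamma0 korobov_alpha_lambda uF.
rewrite -(ler_pM2l (powR_gt0 lambda M0)); apply: le_trans.
rewrite mulr_sumr -sum1_size natr_sum big_seq [leRHS]big_seq; apply: ler_sum => k kF.
have /in_korobov_set : korobov_set alpha gamma M k by exact: FM.
rewrite -powRM ?korobov_rho_ge0 ?(ltW M0)// -[M^-1]mul1r ler_pdivrMr// mulrC => h.
have E1 : 1 `^ lambda = 1 :> R by rewrite powR1.
rewrite -{1}E1 ge0_ler_powR ?nnegrE ?(ltW korobov_lambda_gt0)//.
exact: le_trans ler01 h.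
Qed.

(** Outside the set rho <= 1/M, so splitting rho^2 = rho^(2 - lambda) rho^lambda gains M^(lambda -
    2), because lambda < 2. *)
Lemma sum_rho_sqr_le F : uniq F -> (forall k, k \in F -> ~ korobov_set alpha gamma M k) ->
  \sum_(k <- F) rho k ^+ 2 <= M `^ (lambda - 2) * S.
Proof.
move=> uF FM; have M0 : 0 < M by exact: lt_le_trans M1.
have := sum_rho_powR_le gamma0 korobov_alpha_lambda uF.
rewrite -(ler_pM2l (powR_gt0 (lambda - 2) M0)); apply: le_trans.
rewrite mulr_sumr big_seq [leRHS]big_seq; apply: ler_sum => k kF.
have := korobov_rho_ge0 gamma0 alpha k; rewrite le_eqVlt => /predU1P[<-|r0].
  by rewrite expr0n mulr_ge0 ?powR_ge0.
have rM : rho k <= M^-1.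
  by rewrite leNgt; apply/negP => /ltW /in_korobov_set; exact: FM.
have -> : rho k ^+ 2 = rho k `^ (2 - lambda) * rho k `^ lambda.
  by rewrite -powRD ?subrK ?gt_eqF ?implybT// powR_mulrn ?ltW.
have -> : M `^ (lambda - 2) = M^-1 `^ (2 - lambda).
  by rewrite -powR_inv1 ?(ltW M0)// -powRrM mulN1r opprB.
rewrite ler_wpM2r ?powR_ge0// ge0_ler_powR ?nnegrE ?subr_ge0 ?invr_ge0 ?(ltW M0)//.
- exact: ltW.
- exact: ltW.
Qed.

Lemma weighted_coef_sum_le1 (f : 'rV[R]_d -> R[i]) F : uniq F ->
  (korobov_norm alpha gamma f <= 1)%E ->
  (forall k, k \in F -> gamma (labels (supp k)) != 0) ->
  \sum_(k <- F) ((rho k)^-1 * normc (fourier_coef f k)) ^+ 2 <= 1.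
Proof.
move=> uF norm1 Fg.
pose a k := (korobov_r alpha gamma k ^+ 2 * (normc (fourier_coef f k) ^+ 2)%:E)%E.
have le_esum : ((\sum_(k <- F) ((rho k)^-1 * normc (fourier_coef f k)) ^+ 2)%:E <=
    \esum_(k in [set k | gamma (labels (supp k)) != 0%R]) a k)%E.
  apply: esum_ge; exists [set` F].
    by split; [exact: finite_seq | move=> k /= /Fg].
  rewrite -fsbig_seq// -sumEFin big_seq [leRHS]big_seq; apply: lee_sum => k kF.
  by rewrite /a korobov_rE ?Fg// -EFin_expe -EFinM exprMn.
have: (\esum_(k in [set k | gamma (labels (supp k)) != 0%R]) a k <= 1)%E.
  move: norm1; rewrite /korobov_norm -/a.
  case: (esum _ _) => [r| |] /=; [|by rewrite gt_eqF ?invr_gt0|by rewrite leNye].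
  rewrite !lee_fin => r1; rewrite leNgt; apply/negP => r_gt1.
  move: r1; apply/negP; rewrite -ltNge.
  have E1 : 1 `^ 2^-1 = 1 :> R by rewrite powR1.
  rewrite -{1}E1; apply: gt0_ltr_powR => //; rewrite ?nnegrE ?invr_gt0//.
  exact: le_trans ler01 (ltW r_gt1).
by move=> /(le_trans le_esum); rewrite lee_fin.
Qed.

Lemma coef_sum_le (f : 'rV[R]_d -> R[i]) F (D : R) : uniq F -> 0 < D ->
  korobov_space alpha gamma f -> (korobov_norm alpha gamma f <= 1)%E ->
  \sum_(k <- F) rho k ^+ 2 <= D ^+ 2 ->
  \sum_(k <- F) normc (fourier_coef f k) <= D.
Proof.
move=> uF D0 [_ _ f0 _] norm1 rhoD.
pose b k := (rho k)^-1 * normc (fourier_coef f k).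
have b1 : \sum_(k <- F | gamma (labels (supp k)) != 0) b k ^+ 2 <= 1.
  rewrite -big_filter; apply: weighted_coef_sum_le1 => //; first exact: filter_uniq.
  by move=> k; rewrite mem_filter => /andP[].
(* Cauchy-Schwarz in the form of a weighted AM-GM inequality, rho b <= rho^2 / (2D) + D b^2 / 2. The
   two sums then contribute at most D/2 each. *)
have le_k k : normc (fourier_coef f k) <=
    (2 * D)^-1 * rho k ^+ 2 + D / 2 * (if gamma (labels (supp k)) != 0 then b k ^+ 2 else 0).
  have [g0|g0] := eqVneq (gamma (labels (supp k))) 0.
    rewrite f0// ComplexField.Normc.normc0 /= mulr0 addr0.
    by rewrite mulr_ge0 ?sqr_ge0// invr_ge0 mulr_ge0// ltW.
  have r0 : rho k != 0 by rewrite korobov_rho_eq0.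
  have -> : normc (fourier_coef f k) = rho k * b k by rewrite /b mulVKf.
  rewrite -subr_ge0 (_ : _ - _ = (2 * D)^-1 * (rho k - D * b k) ^+ 2); last first.
    by rewrite /=; field; rewrite gt_eqF.
  by rewrite mulr_ge0 ?sqr_ge0// invr_ge0 mulr_ge0// ltW.
apply: (le_trans (ler_sum _ (fun k _ => le_k k))).
rewrite big_split /= -!mulr_sumr -big_mkcond /=.
apply: (@le_trans _ _ ((2 * D)^-1 * D ^+ 2 + D / 2 * 1)); last first.
  by rewrite le_eqVlt; apply/orP; left; apply/eqP; field; rewrite gt_eqF.
by apply: lerD; apply: ler_wpM2l => //; [rewrite invr_ge0 mulr_ge0// ltW | rewrite divr_ge0// ltW].
Qed.

Lemma korobov_tail_le (f : 'rV[R]_d -> R[i]) (A : {fset 'rV[int]_d}) F :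
  (forall k, k \in A <-> korobov_set alpha gamma M k) -> (0 < #|` A|)%N ->
  korobov_space alpha gamma f -> (korobov_norm alpha gamma f <= 1)%E ->
  uniq F -> (forall k, k \in F -> k \notin A) ->
  \sum_(k <- F) normc (fourier_coef f k) <=
    #|` A|%:R `^ (- (1 / lambda - 1 / 2)) * S `^ (1 / lambda).
Proof.
move=> AE A0 fH f1 uF FA; have M0 : 0 < M by exact: lt_le_trans M1.
have l0 := korobov_lambda_gt0.
have S0 : 0 < S by exact: lt_le_trans korobov_S_ge1.
set a : R := #|` A|%:R; have a0 : 0 < a by rewrite ltr0n.
apply: coef_sum_le => //; first by rewrite mulr_gt0 ?powR_gt0.
have FM k : k \in F -> ~ korobov_set alpha gamma M k.
  by move=> /FA kA /AE; exact/negP.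
apply: (le_trans (sum_rho_sqr_le uF FM)).
have aM : a / S <= M `^ lambda.
  rewrite ler_pdivrMr//; apply: card_korobov_le; first exact: fset_uniq.
  by move=> k /AE.
(* M^(lambda - 2) is (M^lambda)^(-th) with th > 0, so the lower bound |A| / S on M^lambda becomes an
   upper bound. The square of the target is exactly (|A| / S)^(-th) S. *)
pose th := 2 / lambda - 1.
have th0 : 0 < th by rewrite subr_gt0 ltr_pdivlMr// mul1r.
have -> : M `^ (lambda - 2) = (M `^ lambda) `^ (- th).
  by rewrite -powRrM; congr (_ `^ _); rewrite /th; field; rewrite gt_eqF.
have -> : (a `^ (- (1 / lambda - 1 / 2)) * S `^ (1 / lambda)) ^+ 2 = (a / S) `^ (- th) * S.
  rewrite exprMn -!powR_mulrn ?powR_ge0// -!powRrM powRM ?invr_ge0 ?(ltW a0) ?(ltW S0)//.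
  rewrite -mulrA; congr (_ `^ _ * _); first by rewrite /th; field; rewrite gt_eqF.
  rewrite -(powR_inv1 (ltW S0)) -powRrM -[X in _ = _ * X]powRr1 ?(ltW S0)// -powRD; last first.
    by rewrite (gt_eqF S0) implybT.
  by congr (_ `^ _); rewrite /th; field; rewrite gt_eqF.
rewrite ler_wpM2r ?(ltW S0)// !powRN lef_pV2 ?posrE ?powR_gt0 ?divr_gt0//.
by rewrite ge0_ler_powR ?nnegrE ?powR_ge0 ?divr_ge0 ?(ltW th0) ?(ltW a0) ?(ltW S0).
Qed.

End KorobovTail.

(** * The primes of Algorithm LC *)

Section LcPrime.
Context {R : realType} {d : nat}.
Variables (A : {fset 'rV[int]_d}) (c : R).
Hypothesis eta_spread : (spread A)%:~R <= lc_eta A c.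
Hypothesis eta_ge0 : 0 <= lc_eta A c.
Local Notation eta := (lc_eta A c).

Lemma coord_le_spread k h j : k \in A -> h \in A -> k 0 j - h 0 j <= spread A.
Proof.
move=> kA hA.
have k_max : k 0 j <= coord_max A j.
  exact: (@le_bigmax_seq _ _ _ _ _ k xpredT (fun k : 'rV[int]_d => k 0 j)).
have h_min : coord_min A j <= h 0 j.
  exact: (@ge_bigmin_seq _ _ _ _ _ h xpredT (fun k : 'rV[int]_d => k 0 j)).
apply: (@le_trans _ _ (coord_max A j - coord_min A j)); first by rewrite lerB.
exact: (@le_bigmax_cond _ _ _ _ j xpredT (fun j => coord_max A j - coord_min A j)).
Qed.

(** Vectors of A that agree modulo n differ coordinatewise by multiples of n, yet by at most the
    spread, which is below n. Separation is therefore automatic for primes above eta. *)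
Lemma sep_primes_gt_eta (n : nat) : eta < n%:R -> sep_primes A n <-> prime n.
Proof.
move=> etan; split=> [[]//|pn]; split=> // k h kA hA /matrixP E.
have sn : spread A < n%:Z.
  by rewrite -(ltr_int R); apply: le_lt_trans etan.
apply/rowP => j; have := E 0 j; rewrite !mxE => /eqP; rewrite eqz_mod_dvd => dvd.
have kh := coord_le_spread j kA hA; have hk := coord_le_spread j hA kA.
apply/eqP; rewrite -subr_eq0; apply: contraTT dvd => nz.
apply/negP => /dvdzP[q E2]; move: nz kh hk; rewrite -[h 0 j - _]opprB E2.
have [-> |q0] := eqVneq q 0; first by rewrite mul0r eqxx.
by nia.
Qed.

Definition big_prime (m : nat) : bool := prime m && (eta < m%:R).
Definition nbig (n : nat) : nat := count big_prime (iota 0 n.+1).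

Lemma nbigS n : nbig n.+1 = (nbig n + big_prime n.+1)%N.
Proof. by rewrite /nbig -[n.+2]addn1 iotaD count_cat /= addn0. Qed.

Lemma leq_nbig : {homo nbig : m n / (m <= n)%N}.
Proof.
apply: homo_leq => [//|y x z|i]; first exact: leq_trans.
by rewrite nbigS leq_addr.
Qed.

Lemma nbig_unbounded t : exists n, (t <= nbig n)%N.
Proof.
elim: t => [|t [n tn]]; first by exists 0%N.
have [p pn pp] := prime_above (maxn n (Num.truncn eta)).
exists p; case: p pn pp => // p pn pp; rewrite nbigS /big_prime pp /=.
have -> : eta < p.+1%:R by rewrite -truncn_lt_nat//; lia.
by rewrite addn1 ltnS (leq_trans tn)// leq_nbig//; lia.
Qed.

Lemma card_big_primes n t :
  ([set m | [/\ sep_primes A m, eta < m%:R & (m <= n)%N]] #= `I_t)%card <-> nbig n = t.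
Proof.
have -> : [set m | [/\ sep_primes A m, eta < m%:R & (m <= n)%N]] =
    [set` [fset m in seq.filter big_prime (iota 0 n.+1)]%fset].
  apply/seteqP; split=> m /=; rewrite !inE mem_filter mem_iota /= ?add0n ltnS /big_prime.
    move=> [sm em mn]; have pm : prime m by exact/(sep_primes_gt_eta em).
    by rewrite pm em mn prime_gt0.
  by move=> /and3P[/andP[pm em] _ mn]; split=> //; apply/(sep_primes_gt_eta em).
split=> [/card_eq_fsetP|<-]; [move=> <-|apply/card_eq_fsetP];
  by rewrite card_fseq undup_id ?filter_uniq ?iota_uniq// size_filter.
Qed.

Lemma lc_primeP t : (0 < t)%N ->
  [/\ sep_primes A (lc_prime A c t), eta < (lc_prime A c t)%:R & nbig (lc_prime A c t) = t].
Proof.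
move=> t0; rewrite /lc_prime.
case: xgetP => [n _ [h1 h2 h3]|none]; first by split=> //; exact/card_big_primes.
(* To rule out the default 0 of [xget], take the least n with at least t big primes up to n. The
   count grows by at most one there, so it equals t and n is itself a big prime. *)
have [n tn nmin] := ex_minnP (nbig_unbounded t).
case: n tn nmin => [|n] tn nmin; first by move: tn; rewrite /nbig /big_prime /=; lia.
have : (nbig n < t)%N by rewrite ltnNge; apply/negP => /nmin; rewrite ltnn.
move: tn; rewrite nbigS; case bp: (big_prime n.+1) => /= tn nt; last by lia.
have [pn en] := andP bp.
case: (none n.+1); split=> //; first exact/(sep_primes_gt_eta en).
apply/card_big_primes; rewrite nbigS bp; lia.
Qed.

(** Among the primes up to the t-th big prime, t exceed eta and at most floor(eta) do not, so their
    number is at most eta + t; Chebyshev's bound does the rest. *)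
Lemma lc_prime_bound t : (0 < t)%N ->
  (lc_prime A c t)%:R <= 6 * (eta + t%:R) * ln (lc_prime A c t)%:R.
Proof.
move=> t0; have [[pn _] en nt] := lc_primeP t0; set n := lc_prime A c t in pn en nt *.
apply: (le_trans (chebyshev_real R (prime_gt1 pn))).
rewrite ler_wpM2r ?ln_ge0 ?ler1n ?prime_gt0// ler_wpM2l//.
have : (nprimes n <= nbig n + Num.truncn eta)%N.
  rewrite /nprimes /nbig.
  have -> : count big_prime (iota 0 n.+1) = count big_prime (iota 1 n) by [].
  have : (count (fun m => (m <= Num.truncn eta)%N) (iota 1 n) <= Num.truncn eta)%N.
    rewrite -size_filter -[leqRHS](size_iota 1); apply: uniq_leq_size.
      by rewrite filter_uniq// iota_uniq.
    by move=> m; rewrite mem_filter !mem_iota; lia.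
  move=> le_e; apply: (@leq_trans (count (predU big_prime (fun m => (m <= Num.truncn eta)%N)) (iota 1 n))).
    apply: sub_count => m pm /=; rewrite /big_prime pm /=.
    by rewrite -truncn_lt_nat// ltnNge orNb.
  by rewrite -(leq_add2r (count (predI big_prime (fun m => (m <= Num.truncn eta)%N)) (iota 1 n)))
    count_predUI; lia.
rewrite nt -(ler_nat R) natrD => /le_trans; apply; rewrite addrC lerD2r.
by rewrite truncn_le.
Qed.

End LcPrime.

(** * The success probability of Algorithm LC *)

Section AliasingCount.
Context {R : realType} {d : nat}.
Variables (A : {fset 'rV[int]_d}) (c : R) (n : nat).
Hypotheses (c1 : 1 < c) (n_sep : sep_primes A n) (n_eta : lc_eta A c < n%:R).
Local Notation grid := ('rV['I_n]_d).

Definition grid_vec (v : grid) : 'rV[int]_d := map_mx (fun i : 'I_n => (i.+1)%:Z) v.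

Lemma prime_dvdzM (p : nat) (x y : int) : prime p ->
  (p %| x * y)%Z -> ~~ (p %| x)%Z -> (p %| y)%Z.
Proof.
move=> pp; rewrite !dvdzE abszM Euclid_dvdM// => /orP[-> //|//].
Qed.

(** Since n separates A, some coordinate i of m - k is not divisible by the prime n. The congruence
    then determines v_i from the other coordinates. *)
Lemma card_alias_pair (k m : 'rV[int]_d) : k \in A -> m \in A -> m != k ->
  (#|[set v : grid | (dot m (grid_vec v) == dot k (grid_vec v) %[mod n])%Z]%SET| * n
    <= n ^ d)%N.
Proof.
move=> kA mA mk; have [pn inj] := n_sep.
have [i di] : exists i, ~~ (n %| (m - k) 0%R i)%Z.
  apply/existsP; rewrite -negb_forall; apply: contra mk => /forallP dvd.
  apply/eqP; apply: inj => //; apply/rowP => j; rewrite !mxE.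
  by apply/eqP; rewrite eqz_mod_dvd; have := dvd j; rewrite !mxE.
have := @card_determined_by_others 'I_n d i
  [set v : grid | (dot m (grid_vec v) == dot k (grid_vec v) %[mod n])%Z]%SET.
rewrite card_ord; apply => v w; rewrite !inE !eqz_mod_dvd !dot_subl => dv dw vw.
apply/rowP => j; have [->|/vw//] := eqVneq j i.
have E : dot (m - k) (grid_vec v) - dot (m - k) (grid_vec w) =
    (m - k) 0 i * ((v 0 i)%:Z - (w 0 i)%:Z).
  rewrite /dot -sumrB (bigD1 i)//= big1 ?addr0 => [|j' ji].
    by rewrite !mxE -mulrBr; congr (_ * _); rewrite !intS; lia.
  by rewrite !mxE vw// subrr.
have : (n %| (v 0%R i)%:Z - (w 0%R i)%:Z)%Z.
  by apply: (prime_dvdzM pn _ di); rewrite -E rpredB.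
move: (v 0 i) (w 0 i) => [a an] [b bn] /= /dvdzP[q Eq]; apply: val_inj => /=.
by have [q0|q0] := eqVneq q 0; [move: Eq; rewrite q0 mul0r; lia | nia].
Qed.

(** A union bound over the |A| - 1 possible aliases, each of proportion at most 1/n, combined with n
    > c (|A| - 1). *)
Lemma card_aliased (k : 'rV[int]_d) : k \in A ->
  #|[set v : grid | ~~ aliasing_free A (n, grid_vec v) k]%SET|%:R <= c^-1 * (n ^ d)%:R.
Proof.
move=> kA; set B := [set v | _]%SET.
pose D m : {set grid} := [set v | (dot m (grid_vec v) == dot k (grid_vec v) %[mod n])%Z]%SET.
have BD : (#|B| <= \sum_(m <- A | m != k) #|D m|)%N.
  apply: (@leq_trans (\sum_(v : grid) \sum_(m <- A | m != k) (v \in D m))).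
    rewrite -sum1_card [leqLHS]big_mkcond; apply: leq_sum => v _; rewrite inE /aliasing_free kA /=.
    rewrite negbK; case: hasP => // -[m mA /andP[mk mdk]].
    by rewrite (big_rem m mA) /= mk inE mdk.
  rewrite exchange_big /=; apply: leq_sum => m _.
  by rewrite -sum1_card [leqRHS]big_mkcond.
have n0 : (0 : R) < n%:R by rewrite ltr0n prime_gt0//; case: n_sep.
have H : (#|B| * n <= (#|` A| - 1) * n ^ d)%N.
  apply: (leq_trans (leq_mul BD (leqnn n))); rewrite big_distrl /=.
  rewrite big_seq_cond; apply: (@leq_trans (\sum_(m <- A | (m \in A) && (m != k)) n ^ d)).
    by apply: leq_sum => m /andP[mA mk]; exact: card_alias_pair.
  rewrite -big_seq_cond big_const_seq iter_addn_0 mulnC leq_mul2r; apply/orP; right.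
  rewrite -(count_predC (pred1 k)) count_uniq_mem ?fset_uniq// kA addKn.
  exact: eq_leq.
have c0 : 0 < c by exact: lt_trans c1.
rewrite ler_pdivlMl// -(ler_pM2r n0) -mulrA -natrM.
apply: (@le_trans _ _ (c * ((#|` A| - 1) * n ^ d)%:R)); first by rewrite ler_pM2l// ler_nat.
rewrite natrM mulrA [leRHS]mulrC ler_wpM2r// natrB ?cardfs_gt0; last first.
  by apply/fset0Pn; exists k.
exact: ltW.
Qed.

End AliasingCount.

Section Potential.
Context {R : realType} {d : nat}.
Variables (A : {fset 'rV[int]_d}) (c delta : R).
Hypothesis c1 : 1 < c.
Hypothesis lc_prime_sep : forall t, (0 < t)%N ->
  sep_primes A (lc_prime A c t) /\ lc_eta A c < (lc_prime A c t)%:R.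
Local Notation L := (Lmax A c delta).
Local Notation state := (lc_state d).
Implicit Types s : state.

(** Each size is recorded only as some p_t with 1 <= t <= [Lmax], which is all that the bound on the
    number of points needs. *)
Definition lc_inv s : Prop :=
  [/\ (s.2 `<=` A)%fset, (size s.1 <= L)%N,
      forall l, l \in s.1 -> exists2 t, (0 < t <= L)%N & l.1 = lc_prime A c t &
      forall k, k \in s.2 -> (1 <= xi A s.1 k)%N].

Lemma lc_inv_init : lc_inv (lc_init d).
Proof. by split=> //; exact: fsub0set. Qed.

Lemma lc_inv_step s (v : 'rV[int]_d) : lc_inv s -> lc_inv (lc_step A c delta s v).
Proof.
move=> [sA sL sp sx]; rewrite /lc_step; case: ifP => [/andP[_ run]|_]; last by split.
set l := (_, v); set At := [fset k in A | _]%fset.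
case: ifP => _; first by split.
split=> /=.
- by rewrite fsubUset sA; apply/fsubsetP => k; rewrite !inE => /andP[].
- by rewrite size_rcons.
- move=> l'; rewrite mem_rcons inE => /predU1P[->|/sp//].
  by exists (size s.1).+1.
- move=> k; rewrite /xi big_rcons/= inE => /orP[/sx|].
    by rewrite /xi => h; rewrite addn_gt0 h ?orbT.
  by rewrite !inE => /andP[_ free]; rewrite addn_gt0 free ?orbT.
Qed.

Lemma lc_run_rcons h (v : 'rV[int]_d) :
  lc_run A c delta (rcons h v) = lc_step A c delta (lc_run A c delta h) v.
Proof. by rewrite /lc_run -cats1 foldl_cat. Qed.

Lemma lc_inv_run h : lc_inv (lc_run A c delta h).
Proof.
elim/last_ind: h => [|h v IH]; first exact: lc_inv_init.
by rewrite lc_run_rcons; exact: lc_inv_step.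
Qed.

Lemma lc_run_stopped h h' : ~~ lc_running A c delta (lc_run A c delta h) ->
  lc_run A c delta (h ++ h') = lc_run A c delta h.
Proof.
move=> stop; elim/last_ind: h' => [|h' v IH]; first by rewrite cats0.
by rewrite -rcons_cat lc_run_rcons IH /lc_step (negbTE stop).
Qed.

Definition lc_bad s : bool := ~~ (A `<=` s.2)%fset.

Lemma lc_bad_ltn s : lc_inv s -> lc_bad s -> (#|` s.2| < #|` A|)%N.
Proof. by move=> [sA _ _ _] bad; apply: fproper_ltn_card; rewrite fproperE sA. Qed.

Lemma lc_running_bad s : lc_inv s -> lc_running A c delta s -> lc_bad s.
Proof.
move=> [sA _ _ _] /andP[run _]; apply: contraTN run => As.
by rewrite -leqNgt fsubset_leq_card.
Qed.

Definition uncovered s : nat := \sum_(k <- A) (k \notin s.2).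

Lemma uncovered_gt0 s : lc_bad s -> (0 < uncovered s)%N.
Proof.
move=> /fsubsetPn[k kA ks]; rewrite /uncovered (big_rem k)//= ks.
by rewrite addSn.
Qed.

(** While the loop runs, a draw is rejected with probability at most 1/c. Acceptance halves 2^(L -
    t) and rejection leaves it unchanged, so its mean is multiplied by at most (1 + 1/c)/2. *)
Definition lc_ratio : R := (1 + c^-1) / 2.

(* A supermartingale along the draws: the first summand dominates the number of
   frequencies left uncovered after [L] accepted lattices, the second one the
   event that the loop is still running after [m] further draws. *)
Definition lc_potential (m : nat) s : R :=
  (uncovered s)%:R * c^-1 ^+ (L - size s.1) + lc_ratio ^+ m * 2 ^+ (L - size s.1).

Let c0 : 0 < c. Proof. exact: lt_trans c1. Qed.

Lemma lc_ratio_ge0 : 0 <= lc_ratio.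
Proof. by rewrite divr_ge0// addr_ge0// invr_ge0 ltW. Qed.

Lemma lc_potential_ge0 m s : 0 <= lc_potential m s.
Proof.
rewrite addr_ge0// mulr_ge0// ?exprn_ge0 ?invr_ge0 ?lc_ratio_ge0//; exact: ltW.
Qed.

Lemma lc_potential_bad0 s : lc_bad s -> 1 <= lc_potential 0 s.
Proof.
move=> bad; rewrite /lc_potential expr0 mul1r -[leLHS]add0r lerD//.
  by rewrite mulr_ge0// exprn_ge0// invr_ge0 ltW.
by rewrite exprn_ege1// ler1n.
Qed.

(** A state that stops without covering A has used all L lattices, so the exponent in the first
    summand is 0 and that summand counts at least one frequency. *)
Lemma lc_potential_stopped m s : lc_inv s -> lc_bad s -> ~~ lc_running A c delta s ->
  1 <= lc_potential m s.
Proof.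
move=> inv bad; rewrite /lc_running (lc_bad_ltn inv bad) /= -leqNgt => sL.
rewrite /lc_potential (eqP (_ : (L - size s.1 == 0)%N)) ?subn_eq0// !expr0 !mulr1.
by rewrite -[leLHS]addr0 lerD ?exprn_ge0 ?lc_ratio_ge0// ler1n uncovered_gt0.
Qed.

(** A frequency is still uncovered only if the draw aliases it, which has probability at most 1/c;
    this compensates the factor c lost when acceptance lowers the exponent L - t. A rejection keeps
    the exponent and is only better. For the second summand see [lc_ratio]. *)
Lemma lc_potential_step m s : lc_inv s -> lc_running A c delta s ->
  \sum_(v : 'rV['I_(lc_next_size A c s)]_d)
      lc_potential m (lc_step A c delta s (grid_vec v)) <=
    (lc_next_size A c s ^ d)%:R * lc_potential m.+1 s.
Proof.
move=> inv run; set n := lc_next_size A c s; have [sA _ _ _] := inv; have [_ sL] := andP run.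
have [n_sep n_eta] := lc_prime_sep (ltn0Sn (size s.1)).
pose e := (L - (size s.1).+1)%N.
have eE : (L - size s.1 = e.+1)%N by rewrite /e; lia.
pose miss (v : 'rV['I_n]_d) k := ~~ aliasing_free A (n, grid_vec v) k.
have c_ge0 j : 0 <= c^-1 ^+ j by rewrite exprn_ge0// invr_ge0 ltW.
have miss_sum k : k \in A -> \sum_v (miss v k)%:R <= c^-1 * (n ^ d)%:R.
  move=> kA; apply: le_trans (card_aliased c1 n_sep n_eta kA).
  rewrite -natr_sum ler_nat -sum1_card [leqRHS]big_mkcond.
  by apply: leq_sum => v _; rewrite inE -/(miss v k); case: (miss v k).
(* A rejected draw covers nothing new, so it must alias this fixed uncovered [k0]; that bounds the
   probability of rejection. *)
have /fsubsetPn[k0 k0A k0s] := lc_running_bad inv run.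
have stepE (v : 'rV['I_n]_d) : let s' := lc_step A c delta s (grid_vec v) in
    (forall k, k \in A -> k \notin s'.2 -> k \notin s.2 /\ miss v k) /\
    ((s'.1 = s.1 /\ miss v k0) \/ size s'.1 = (size s.1).+1).
  rewrite /lc_step run; set At := [fset k in A | _]%fset.
  have memAt k : k \in A -> k \notin At -> miss v k.
    by move=> kA; rewrite !inE kA.
  case: ifP => [/fsubsetP sub|_] /=; split.
  - move=> k kA ks; split=> //; apply: memAt => //; apply: contra ks; exact: sub.
  - left; split=> //; apply: memAt => //; apply: contra k0s; exact: sub.
  - by move=> k kA; rewrite inE negb_or => /andP[ks kAt]; split=> //; exact: memAt.
  - by right; rewrite size_rcons.
have first_le (v : 'rV['I_n]_d) : (uncovered (lc_step A c delta s (grid_vec v)))%:R *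
    c^-1 ^+ (L - size (lc_step A c delta s (grid_vec v)).1) <=
    (\sum_(k <- A) (k \notin s.2)%:R * (miss v k)%:R) * c^-1 ^+ e.
  have [un sz] := stepE v; move: un sz; set s' := lc_step _ _ _ _ _ => un sz.
  apply: ler_pM => //.
    rewrite natr_sum big_seq [leRHS]big_seq; apply: ler_sum => k kA.
    case ks': (k \in s'.2); first by rewrite mulr_ge0.
    by have [-> ->] := un k kA (negbT ks'); rewrite mulr1.
  case: sz => [[-> _]|->]; last exact: lexx.
  by rewrite eE exprS ler_piMl// invf_le1// ltW.
have second_le (v : 'rV['I_n]_d) : 2 ^+ (L - size (lc_step A c delta s (grid_vec v)).1) <=
    2 ^+ e * (1 + (miss v k0)%:R) :> R.
  have [_] := stepE v; set s' := lc_step _ _ _ _ _; case=> [[-> ->]|->].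
    by rewrite eE exprSr.
  by rewrite -[leLHS]mulr1 ler_wpM2l ?exprn_ge0// lerDl.
apply: (@le_trans _ _ (\sum_(v : 'rV['I_n]_d)
    ((\sum_(k <- A) (k \notin s.2)%:R * (miss v k)%:R) * c^-1 ^+ e +
     lc_ratio ^+ m * (2 ^+ e * (1 + (miss v k0)%:R))))).
  apply: ler_sum => v _; rewrite lerD// ler_wpM2l// exprn_ge0// lc_ratio_ge0//.
rewrite big_split /= /lc_potential mulrDr; apply: lerD.
  rewrite -mulr_suml exchange_big /= eE exprS.
  apply: (@le_trans _ _ (\sum_(k <- A) (k \notin s.2)%:R * (c^-1 * (n ^ d)%:R) * c^-1 ^+ e)).
    rewrite mulr_suml big_seq [leRHS]big_seq; apply: ler_sum => k kA.
    by rewrite -mulr_sumr ler_wpM2r// ler_wpM2l// miss_sum.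
  rewrite -2!mulr_suml -natr_sum -/(uncovered s) le_eqVlt; apply/orP; left; apply/eqP.
  move: ((uncovered s)%:R : R) ((n ^ d)%:R : R) (c^-1 ^+ e) => x y z.
  by ring.
rewrite -!mulr_sumr big_split /= sumr_const card_mx card_ord mul1n eE.
apply: (@le_trans _ _ (lc_ratio ^+ m * (2 ^+ e * ((n ^ d)%:R + c^-1 * (n ^ d)%:R)))).
  rewrite ler_wpM2l ?exprn_ge0 ?lc_ratio_ge0// ler_wpM2l ?exprn_ge0// lerD// miss_sum//.
rewrite le_eqVlt; apply/orP; left; apply/eqP; rewrite !exprS /lc_ratio.
move: (_ ^+ m) (2 ^+ e) ((n ^ d)%:R) => x y z.
by field; rewrite gt_eqF.
Qed.

End Potential.

(** * Probabilities along the sequence of draws *)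

Section Draws.
Context {R : realType} {d : nat}.
Variables (A : {fset 'rV[int]_d}) (c delta : R).
Hypothesis c1 : 1 < c.
Hypothesis lc_prime_sep : forall t, (0 < t)%N ->
  sep_primes A (lc_prime A c t) /\ lc_eta A c < (lc_prime A c t)%:R.
Variables (disp : measure_display) (Omega : measurableType disp).
Variables (P : probability Omega R) (g : nat -> Omega -> 'rV[int]_d).
Hypothesis draws : lc_draws A c delta P g.
Local Notation L := (Lmax A c delta).
Local Notation run := (lc_run A c delta).
Implicit Types (h : seq 'rV[int]_d) (E F : set Omega).

Let pr E : R := fine (P E).

Let PE E : measurable E -> P E = (pr E)%:E.
Proof. by move=> mE; rewrite fineK// fin_num_measure. Qed.

Let pr_ge0 E : 0 <= pr E.
Proof. exact/fine_ge0/measure_ge0. Qed.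

Let le_pr E F : measurable E -> measurable F -> E `<=` F -> pr E <= pr F.
Proof. by move=> mE mF EF; rewrite -lee_fin -!PE// le_measure ?inE. Qed.

Let sum_disjoint_le (T : eqType) (s : seq T) (F : T -> set Omega) E :
  uniq s -> measurable E -> (forall x, measurable (F x)) -> (forall x, F x `<=` E) ->
  (forall x y w, F x w -> F y w -> x = y) -> \sum_(x <- s) pr (F x) <= pr E.
Proof.
elim: s F E => [|x s IH] F E; first by rewrite big_nil.
rewrite cons_uniq => /andP[xs us] mE mF FE Fdisj; rewrite big_cons.
have mD : measurable (E `\` F x) by exact: measurableD.
have -> : pr E = pr (F x) + pr (E `\` F x).
  apply: EFin_inj; rewrite EFinD -!PE// addeC (measureDI P mE (mF x)).
  by rewrite (setIidr (FE x)).
rewrite lerD2l.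
(* The induction hypothesis requires every member of the family to lie in E minus F x, including the
   one at index x itself, which is therefore emptied. *)
pose F' y := if y == x then set0 else F y.
have F'_le : \sum_(y <- s) pr (F' y) <= pr (E `\` F x).
  apply: IH => //; rewrite /F'.
  - by move=> y; case: ifP.
  - move=> y; case: eqP => [_|yx] w //= Fyw; split; first exact: FE Fyw.
    by move=> Fxw; apply: yx; exact: Fdisj Fyw Fxw.
  - by move=> y z w; case: eqP => // _; case: eqP => // _; exact: Fdisj.
apply: le_trans F'_le; rewrite big_seq [leRHS]big_seq; apply: ler_sum => y ys.
by rewrite /F'; case: eqP => // yx; move: xs; rewrite -yx ys.
Qed.

Definition prefix_draws m (w : Omega) : seq 'rV[int]_d := mkseq (g^~ w) m.

Lemma measurable_cylinder h : measurable [set w | prefix_draws (size h) w = h].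
Proof.
elim/last_ind: h => [|h v IH].
  by rewrite (_ : mkset _ = setT)//; apply/seteqP; split.
have -> : [set w | prefix_draws (size (rcons h v)) w = rcons h v] =
    [set w | prefix_draws (size h) w = h] `&` (g (size h) @^-1` [set v]).
  apply/seteqP; split=> w /=; rewrite size_rcons /prefix_draws mkseqS.
    by move=> /rcons_inj[-> ->].
  by move=> [-> ->].
by apply: measurableI => //; have [+ _] := draws; apply.
Qed.

(** There are countably many finite histories, so every predicate on them is a countable union of
    cylinders. *)
Lemma measurable_prefix m (Q : seq 'rV[int]_d -> Prop) :
  measurable [set w | Q (prefix_draws m w)].
Proof.
have -> : [set w | Q (prefix_draws m w)] = \bigcup_(h : seq 'rV[int]_d)
    (if `[< Q h /\ size h = m >] then [set w | prefix_draws (size h) w = h] else set0).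
  apply/seteqP; split=> w /=.
    move=> Qw; exists (prefix_draws m w) => //.
    by case: asboolP => [[_ /= ->//]|[]]; split=> //; rewrite size_mkseq.
  by move=> [h _]; case: asboolP => // -[Qh hm] /=; rewrite hm => ->.
apply: countable_bigcupT_measurable; first exact: countableP.
by move=> h; case: ifP => _; [exact: measurable_cylinder | exact: measurable0].
Qed.

Lemma prefix_draws_cat h m w : prefix_draws (size h) w = h ->
  exists h', prefix_draws (size h + m) w = h ++ h'.
Proof.
move=> hw; exists (drop (size h) (prefix_draws (size h + m) w)).
rewrite -{2}hw -{1}(cat_take_drop (size h) (prefix_draws (size h + m) w)); congr (_ ++ _).
by rewrite /prefix_draws /mkseq -map_take take_iota (minn_idPl _) ?leq_addr.
Qed.

(** The supermartingale estimate, by induction on the number m of further draws: the cylinder of h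
    contains the disjoint cylinders of its one-draw extensions. Both sides carry the probability of
    the cylinder, which avoids conditioning on null events. *)
Lemma covered_prob_ge m h :
  pr [set w | prefix_draws (size h) w = h] * (1 - lc_potential A c delta m (run h)) <=
  pr [set w | prefix_draws (size h) w = h /\
              ~~ lc_bad A (run (prefix_draws (size h + m) w))].
Proof.
have inv h' : lc_inv A c delta (run h') by exact: lc_inv_run.
have mEv k h' : measurable [set w | prefix_draws (size h') w = h' /\
    ~~ lc_bad A (run (prefix_draws (size h' + k) w))].
  apply: measurableI; first exact: measurable_cylinder.
  exact: (measurable_prefix (size h' + k) (fun h => ~~ lc_bad A (run h))).
have triv_le (x y : R) : 0 <= x -> 1 <= y -> x * (1 - y) <= 0.
  by move=> x0 y1; rewrite mulr_ge0_le0// subr_le0.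
elim: m h => [|m IH] h.
  case bad: (lc_bad A (run h)).
    by apply: (@le_trans _ _ 0) => //; apply: triv_le => //; exact: lc_potential_bad0.
  rewrite addn0 (_ : [set w | _ /\ _] = [set w | prefix_draws (size h) w = h]).
    by rewrite ler_piMr// gerBl lc_potential_ge0.
  by apply/seteqP; split=> w /= [] // ->; rewrite bad.
have [running|stopped] := boolP (lc_running A c delta (run h)); last first.
  case bad: (lc_bad A (run h)).
    by apply: (@le_trans _ _ 0) => //; apply: triv_le => //; exact: lc_potential_stopped.
  rewrite (_ : [set w | _ /\ _] = [set w | prefix_draws (size h) w = h]).
    by rewrite ler_piMr// gerBl lc_potential_ge0.
  apply/seteqP; split=> w /= [] // hw; split=> //.
  by have [h' ->] := prefix_draws_cat m.+1 hw; rewrite lc_run_stopped// bad.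
set n := lc_next_size A c (run h).
have n0 : (0 < n)%N by have [[/prime_gt0]] := lc_prime_sep (ltn0Sn (size (run h).1)).
have nd0 : (0 : R) < (n ^ d)%:R by rewrite ltr0n expn_gt0 n0.
pose Ev (v : 'rV['I_n]_d) := [set w | prefix_draws (size (rcons h (grid_vec v))) w = rcons h (grid_vec v) /\
   ~~ lc_bad A (run (prefix_draws (size (rcons h (grid_vec v)) + m) w))].
have pr_rcons (v : 'rV['I_n]_d) :
    pr [set w | prefix_draws (size (rcons h (grid_vec v))) w = rcons h (grid_vec v)] =
    pr [set w | prefix_draws (size h) w = h] / (n ^ d)%:R.
  apply: EFin_inj; rewrite EFinM -!PE; try exact: measurable_cylinder.
  have [_ /(_ h (grid_vec v) running)] := draws; rewrite -/n => <-.
    by rewrite size_rcons.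
  by move=> j; rewrite mxE lez_nat /= ltn_ord.
apply: (@le_trans _ _ (\sum_(v : 'rV['I_n]_d) pr (Ev v))); last first.
  rewrite -big_enum /=; apply: sum_disjoint_le.
  - exact: enum_uniq.
  - exact: mEv.
  - by move=> v; exact: mEv.
  - move=> v w [] /=; rewrite size_rcons /prefix_draws mkseqS => /rcons_inj[hw _].
    by rewrite addSnnS => good; split.
  - move=> v v' w [+ _] [+ _]; rewrite !size_rcons => -> /rcons_inj[].
    move=> /matrixP E; apply/matrixP => i j; have := E i j; rewrite !mxE => -[ij].
    exact: val_inj.
apply: (@le_trans _ _ (\sum_(v : 'rV['I_n]_d) pr [set w | prefix_draws (size h) w = h] / (n ^ d)%:R *
    (1 - lc_potential A c delta m (lc_step A c delta (run h) (grid_vec v))))); last first.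
  by apply: ler_sum => v _; rewrite -(pr_rcons v) -lc_run_rcons; exact: IH.
rewrite -mulr_sumr -mulrA ler_wpM2l// ler_pdivlMl//.
rewrite sumrB sumr_const card_mx card_ord mul1n mulrBr mulr1 lerD2l lerN2.
exact: lc_potential_step.
Qed.

(** Within m draws the failure probability is at most |A| c^(-L) + lc_ratio^m 2^L. Since L is fixed
    and the ratio is below 1, letting m tend to infinity leaves the first term. *)
Lemma lc_success_prob (Q : seq (lattice d) -> Prop) :
  #|` A|%:R * c^-1 ^+ L <= delta ->
  (forall h, ~~ lc_bad A (run h) -> Q (run h).1) ->
  let success := [set w | exists ls, lc_output A c delta g w ls /\ Q ls] in
  measurable success /\ ((1 - delta)%:E <= P success)%E.
Proof.
move=> Adelta HQ success.
have sE : success = \bigcup_m [set w | ~~ lc_running A c delta (run (prefix_draws m w)) /\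
    Q (run (prefix_draws m w)).1].
  apply/seteqP; split=> w.
    by move=> [ls [[m [stop lsE]]]]; rewrite lsE => Qls; exists m.
  by move=> [m _ [stop Qm]]; exists (run (prefix_draws m w)).1; split=> //; exists m.
have msuccess : measurable success.
  rewrite sE; apply: bigcupT_measurable => m.
  exact: (measurable_prefix m (fun h => ~~ lc_running A c delta (run h) /\ Q (run h).1)).
split=> //; rewrite PE// lee_fin.
have prT : pr setT = 1 by rewrite /pr probability_setT.
have bound m : 1 - delta <= pr success + lc_ratio c ^+ m * 2 ^+ L.
  have := covered_prob_ge m [::].
  rewrite (_ : [set w | prefix_draws _ w = [::]] = setT); last by apply/seteqP; split.
  rewrite prT mul1r add0n => H.
  have : pr [set w | prefix_draws 0 w = [::] /\ ~~ lc_bad A (run (prefix_draws m w))] <= pr success.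
    apply: le_pr => //.
      apply: measurableI; first exact: (measurable_cylinder [::]).
      exact: (measurable_prefix m (fun h => ~~ lc_bad A (run h))).
    move=> w [_ good]; rewrite sE; exists m => //; split; last exact: HQ.
    by apply: contra good; apply: lc_running_bad; exact: lc_inv_run.
  move=> /(le_trans H); rewrite /lc_potential /= subn0.
  have -> : uncovered A (lc_init d) = #|` A|.
    by rewrite /uncovered -sum1_size; apply: eq_bigr.
  by move: (#|` A|%:R * c^-1 ^+ L) (lc_ratio c ^+ m * 2 ^+ L) Adelta => x y; lra.
have ratio1 : `|lc_ratio c| < 1.
  rewrite ger0_norm ?lc_ratio_ge0// /lc_ratio ltr_pdivrMr// mul1r.
  by rewrite [ltRHS](_ : 2 = 1 + 1)// ltrD2l invf_lt1// (lt_trans ltr01).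
have lim : (fun m => pr success + lc_ratio c ^+ m * 2 ^+ L) @ \oo --> pr success + 0 * 2 ^+ L.
  apply: cvgD; first exact: cvg_cst.
  by apply: cvgM; [exact: cvg_expr | exact: cvg_cst].
rewrite mul0r addr0 in lim.
rewrite -(cvg_lim _ lim)//; apply: limr_ge; first exact: cvgP lim.
by apply: nearW => m; exact: bound.
Qed.

End Draws.

(** * The number of points and the rate *)

Section LmaxBound.
Context {R : realType}.

(* [Lmax] is calibrated by Hoeffding's rate [exp (- 2 * (1 - q) ^+ 2)]; this
   compares it with the geometric rate [q]. *)
Lemma ln_ge_sqr (q : R) : 0 < q < 1 -> 2 * (1 - q) ^+ 2 <= - ln q.
Proof.
move=> /andP[q0 q1].
(* The factor 2 makes the derivative the perfect square (1 - 2x)^2 over x, so f increases up to f(1)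
   = 0. *)
pose f (x : R) := 2 * (1 - x) ^+ 2 + ln x.
have df (x : R) : 0 < x -> is_derive x 1 f ((1 - 2 * x) ^+ 2 / x).
  move=> x0; have dln := is_derive1_ln x0.
  apply: is_derive_eq.
  by rewrite /GRing.scale /=; field; rewrite gt_eqF.
have mono : {in `[q, 1] &, {homo f : x y / x <= y}}.
  apply: ger0_derive1_le_cc => x.
  - by rewrite in_itv/= => /andP[qx _]; have [] := df x (lt_trans q0 qx).
  - rewrite in_itv/= => /andP[qx _]; have x0 := lt_trans q0 qx; have dfx := df x x0.
    by rewrite derive1E derive_val divr_ge0 ?sqr_ge0// ltW.
  - apply: derivable_within_continuous => {}x; rewrite in_itv/= => /andP[qx _].
    by have [] := df x (lt_le_trans q0 qx).
have fq : f q <= f 1 by apply: mono; rewrite ?in_itv/= ?lexx ?(ltW q1).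
by move: fq; rewrite /f ln1 subrr expr0n mulr0 addr0; lra.
Qed.

Lemma ln_le_powR (x t : R) : 0 < x -> 0 < t -> ln x <= x `^ t / t.
Proof.
move=> x0 t0; rewrite ler_pdivlMr// mulrC -ln_powR.
by apply/ltW/ln_sublinear; exact: powR_gt0.
Qed.

Section Lmax.
Variables (c delta : R).
Hypotheses (c1 : 1 < c) (delta0 : 0 < delta) (delta1 : delta < 1).

Let X (a : R) : R := (c / (c - 1)) ^+ 2 * ((ln a - ln delta) / 2).

Let ln_delta : ln delta < 0. Proof. by rewrite ln_lt0// delta0. Qed.

Lemma Lmax_bounds d (A : {fset 'rV[int]_d}) : (0 < #|` A|)%N ->
  X #|` A|%:R <= (Lmax A c delta)%:R <= X #|` A|%:R + 1.
Proof.
move=> A0; rewrite /Lmax -/(X _); set x := X _.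
have x0 : 0 <= x.
  rewrite mulr_ge0 ?sqr_ge0// divr_ge0// subr_ge0 (le_trans (ltW ln_delta))//.
  by rewrite ln_ge0// ler1n.
rewrite natr_absz ger0_norm; last by rewrite ceil_ge0; lra.
by rewrite ceil_ge /=; have := ceilB1_lt x; rewrite intrB; lra.
Qed.

Lemma Lmax_failure d (A : {fset 'rV[int]_d}) : (0 < #|` A|)%N ->
  #|` A|%:R * c^-1 ^+ Lmax A c delta <= delta.
Proof.
move=> A0; have /andP[XL _] := Lmax_bounds A0.
move: (Lmax A c delta) XL => L XL; set a : R := #|` A|%:R in XL *.
have a0 : 0 < a by rewrite ltr0n.
have c0 : 0 < c by exact: lt_trans c1.
have q0 : 0 < c^-1 by rewrite invr_gt0.
have q1 : c^-1 < 1 by rewrite invf_lt1.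
have la : 0 <= ln a by rewrite ln_ge0// ler1n.
have q01 : 0 < c^-1 < 1 by rewrite q0 q1.
have key := ln_ge_sqr q01.
have XE : 2 * (1 - c^-1) ^+ 2 * X a = ln a - ln delta.
  by rewrite /X; field; rewrite ?subr_eq0 !gt_eqF.
have key2 : ln a - ln delta <= - ln c^-1 * L%:R.
  rewrite -XE; apply: ler_pM => //; first by rewrite mulr_ge0 ?sqr_ge0.
  rewrite mulr_ge0 ?sqr_ge0// divr_ge0// subr_ge0 (le_trans (ltW ln_delta))//.
rewrite -ler_ln ?posrE ?mulr_gt0 ?exprn_gt0// lnM ?posrE ?exprn_gt0// lnXn// -mulr_natr.
by move: key2; rewrite mulNr; move: (ln c^-1 * L%:R) => z; lra.
Qed.

Lemma Lmax_le_powR (t : R) : 0 < t -> exists2 K : R, 1 <= K &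
  forall d (A : {fset 'rV[int]_d}), (0 < #|` A|)%N ->
    (Lmax A c delta)%:R <= K * #|` A|%:R `^ t.
Proof.
move=> t0; pose kap := (c / (c - 1)) ^+ 2; have kap0 : 0 <= kap by exact: sqr_ge0.
exists (kap * ((t^-1 - ln delta) / 2) + 1).
  by rewrite lerDr mulr_ge0// divr_ge0// subr_ge0 (le_trans (ltW ln_delta))// invr_ge0 ltW.
move=> d A A0; have /andP[_ LX] := Lmax_bounds A0; apply: (le_trans LX) => {LX}.
set a : R := #|` A|%:R; have a1 : 1 <= a by rewrite ler1n.
have a0 : 0 < a by exact: lt_le_trans a1.
have at1 : 1 <= a `^ t by rewrite -(powRr0 a) ler_powR// ltW.
rewrite mulrDl mul1r lerD// /X -/kap -mulrA ler_wpM2l// mulrAC ler_wpM2r// mulrBl lerB//.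
  by rewrite mulrC ln_le_powR.
by rewrite -[leRHS]mulr1 ler_wnM2l// ltW.
Qed.

End Lmax.

End LmaxBound.

(** * Worst-case error of a covering family of lattices *)

Section DeterministicError.
Context {R : realType} {d : nat}.
Variables (alpha lambda M : R) (gamma : {fset nat} -> R).
Hypotheses (gamma0 : forall u, 0 <= gamma u) (gamma_empty : gamma fset0 = 1).
Hypotheses (alpha_gt : 1 / 2 < alpha) (lambda_gt : 1 / alpha < lambda).
Hypotheses (lambda_lt2 : lambda < 2) (M1 : 1 <= M).
Variable A : {fset 'rV[int]_d}.
Hypothesis AE : forall k, k \in A <-> korobov_set alpha gamma M k.
Hypothesis A0 : (0 < #|` A|)%N.
Variable ls : seq (lattice d).
Hypothesis ls_pos : forall l, l \in ls -> (0 < l.1)%N.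
Hypothesis covered : forall k, k \in A -> (1 <= xi A ls k)%N.

Lemma err_infty_le :
  (err_infty alpha gamma (@A_mult d A R ls) <=
    ((1 + (size ls)%:R) * (#|` A|%:R `^ (- (1 / lambda - 1 / 2)) *
       @korobov_S R d gamma alpha lambda `^ (1 / lambda)))%:E)%E.
Proof.
set B := _ `^ _ * _ `^ _.
apply: ge_ereal_sup => _ [f [fH f1] <-]; apply: ge_ereal_sup => _ [x _ <-].
rewrite lee_fin; have [cf pf _ _] := fH.
have [s Ts] := point_functional_A_mult A ls x.
rewrite Ts; apply: point_functional_le => // K uK.
have T_in k : k \in A -> \sum_(p <- s) p.1 * cis (phase k p.2) = 0.
  by move=> kA; rewrite -(Ts (fun y => cis (phase k y))) A_mult_cis_in// subrr.
have T_le k : normc (\sum_(p <- s) p.1 * cis (phase k p.2)) <= 1 + (size ls)%:R.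
  rewrite -(Ts (fun y => cis (phase k y))); apply: (le_trans (le_normcD _ _)).
  by rewrite normcN normc_cis lerD2l normc_A_mult_cis.
apply: (@le_trans _ _ (\sum_(k <- K | k \notin A) normc (fourier_coef f k) * (1 + (size ls)%:R))).
  rewrite [leRHS]big_mkcond; apply: ler_sum => k _; case: ifPn => [_|/negPn kA].
    by rewrite ler_wpM2l// normc_ge0.
  by rewrite T_in// ComplexField.Normc.normc0 mulr0.
rewrite -mulr_suml mulrC ler_wpM2l//.
rewrite -big_filter.
apply: (korobov_tail_le gamma0 gamma_empty alpha_gt lambda_gt lambda_lt2 M1 AE A0 fH f1).
  exact: filter_uniq.
by move=> k; rewrite mem_filter => /andP[].
Qed.

End DeterministicError.

(** * Number of points compared with the number of frequencies *)

Section PointCount.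
Context {R : realType}.
Variables (c delta beta : R).
Hypotheses (c1 : 1 < c) (delta0 : 0 < delta) (delta1 : delta < 1).
Hypotheses (beta0 : 0 < beta).

Lemma total_points_le : exists2 K : R, 1 <= K &
  forall d (A : {fset 'rV[int]_d}) (ls : seq (lattice d)),
    (0 < #|` A|)%N -> (spread A)%:~R <= lc_eta A c -> 0 <= lc_eta A c ->
    (size ls <= Lmax A c delta)%N ->
    (forall l, l \in ls -> exists2 t, (0 < t <= Lmax A c delta)%N & l.1 = lc_prime A c t) ->
    (total_points ls)%:R <= K * #|` A|%:R `^ (1 + beta).
Proof.
have [K1 K1_ge1 LK1] := Lmax_le_powR c delta0 delta1 (@ltr01 R).
have b2 : 0 < beta / 2 by rewrite divr_gt0.
have [Kb Kb_ge1 LKb] := Lmax_le_powR c delta0 delta1 b2.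
(* Chosen so that 1 - eps = 1 / (1 + beta/2): with ln n <= n^eps / eps, the prime bound becomes n^(1
   - eps) <= K2 |A|, and raising it to the power 1 + beta/2 isolates n. *)
pose eps := beta / (2 + beta).
have eps0 : 0 < eps by rewrite divr_gt0// addr_gt0.
have eps1 : 1 - eps = (1 + beta / 2)^-1.
  by rewrite /eps; field; rewrite !gt_eqF// ?addr_gt0.
pose K2 := 6 * (c + K1) / eps.
have c0 : 0 < c by exact: lt_trans c1.
have K2_gt0 : 0 < K2 by rewrite divr_gt0// mulr_gt0// addr_gt0// (lt_le_trans ltr01).
pose K3 := K2 `^ (1 + beta / 2).
have K3_gt0 : 0 < K3 by rewrite powR_gt0.
exists (Num.max 1 (Kb * K3)); first by rewrite le_max lexx.
move=> d A ls A0 sp eta0 lsL lsp; set a : R := #|` A|%:R.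
have a1 : 1 <= a by rewrite ler1n.
have a0 : 0 < a by exact: lt_le_trans a1.
have lp l : l \in ls -> l.1%:R <= K3 * a `^ (1 + beta / 2).
  move=> /lsp[t /andP[t0 tL] ->].
  have := lc_prime_bound sp eta0 t0; have [[pn _] _ _] := lc_primeP sp eta0 t0.
  set n := lc_prime A c t in pn *; move=> nle.
  have n0 : (0 : R) < n%:R by rewrite ltr0n prime_gt0.
  have tR : t%:R <= K1 * a.
    by have := LK1 d A A0; rewrite powRr1 ?(ltW a0)//; apply: le_trans; rewrite ler_nat.
  have nle2 : n%:R <= K2 * a * n%:R `^ eps.
    apply: (le_trans nle).
    have -> : K2 * a * n%:R `^ eps = 6 * (c + K1) * a * (n%:R `^ eps / eps).
      by rewrite /K2; move: (n%:R `^ eps) => z; ring.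
    apply: ler_pM; last exact: ln_le_powR.
    - by rewrite mulr_ge0// addr_ge0.
    - by rewrite ln_ge0// ler1n prime_gt0.
    rewrite -mulrA ler_wpM2l// mulrDl lerD// /lc_eta ler_wpM2l ?(ltW c0)//.
    by rewrite gerBl.
  have ne : n%:R `^ (1 - eps) <= K2 * a.
    rewrite powRD ?(gt_eqF n0) ?implybT// powRr1 ?(ltW n0)// powRN.
    by rewrite ler_pdivrMr ?powR_gt0.
  have -> : n%:R = (n%:R `^ (1 - eps)) `^ (1 + beta / 2) :> R.
    by rewrite -powRrM eps1 mulVf ?powRr1 ?(ltW n0)// gt_eqF// addr_gt0.
  rewrite /K3 -powRM ?(ltW a0) ?(ltW K2_gt0)//.
  have b20 : 0 <= 1 + beta / 2 by rewrite addr_ge0// ltW.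
  have K2a0 : 0 <= K2 * a by rewrite mulr_ge0 ?(ltW K2_gt0) ?(ltW a0).
  by rewrite ge0_ler_powR ?nnegrE ?powR_ge0 ?K2a0.
apply: (@le_trans _ _ ((Kb * a `^ (beta / 2)) * (K3 * a `^ (1 + beta / 2)))).
  apply: (@le_trans _ _ ((Lmax A c delta)%:R * (K3 * a `^ (1 + beta / 2)))); last first.
    by rewrite ler_wpM2r ?LKb// mulr_ge0 ?powR_ge0// ltW.
  apply: (@le_trans _ _ ((size ls)%:R * (K3 * a `^ (1 + beta / 2)))); last first.
    by rewrite ler_wpM2r ?ler_nat// mulr_ge0 ?powR_ge0// ltW.
  rewrite /total_points natr_sum -sum1_size natr_sum mulr_suml big_seq [leRHS]big_seq.
  by apply: ler_sum => l /lp; rewrite mul1r.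
rewrite mulrACA -powRD ?(gt_eqF a0) ?implybT//.
rewrite (_ : beta / 2 + (1 + beta / 2) = 1 + beta); last by field.
by rewrite ler_wpM2r ?powR_ge0// le_max lexx orbT.
Qed.

End PointCount.

Lemma rate_constant (R : realType) (c delta beta lambda : R) :
  1 < c -> 0 < delta < 1 -> 0 < beta < 1 -> 0 < lambda < 2 ->
  exists2 C : R, 0 < C & forall d (A : {fset 'rV[int]_d}) (ls : seq (lattice d)),
    (0 < #|` A|)%N -> (spread A)%:~R <= lc_eta A c -> 0 <= lc_eta A c ->
    (size ls <= Lmax A c delta)%N -> (0 < total_points ls)%N ->
    (forall l, l \in ls -> exists2 t, (0 < t <= Lmax A c delta)%N & l.1 = lc_prime A c t) ->
    (1 + (size ls)%:R) * #|` A|%:R `^ (- (1 / lambda - 1 / 2)) <=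
      C / ((total_points ls)%:R `^ (1 / (lambda * (1 + beta)) - 1 / 2)).
Proof.
move=> c1 /andP[delta0 delta1] /andP[beta0 beta1] /andP[lambda0 lambda2].
set e := 1 / (lambda * (1 + beta)) - 1 / 2; set s := 1 / lambda - 1 / 2.
have s0 : 0 < s by rewrite subr_gt0 ltr_pdivrMr// mulrAC ltr_pdivlMr// !mul1r.
have b2 : 0 < beta / 2 by rewrite divr_gt0.
have [Ks Ks1 LKs] := Lmax_le_powR c delta0 delta1 s0.
have [Kb Kb1 LKb] := Lmax_le_powR c delta0 delta1 b2.
have [K K1 NK] := total_points_le c1 delta0 delta1 beta0.
have K0 : 0 < K by exact: lt_le_trans K1.
have Kb0 : 0 < Kb by exact: lt_le_trans Kb1.
have Ks0 : 0 < Ks by exact: lt_le_trans Ks1.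
(* The first summand serves e >= 0, the second e < 0, which happens when lambda (1 + beta) > 2. *)
exists (2 * Kb * K `^ e + 2 * Ks).
  by rewrite addr_gt0 ?mulr_gt0 ?powR_gt0.
move=> d A ls A0 sp eta0 lsL N0 lsp; set a : R := #|` A|%:R.
have a1 : 1 <= a by rewrite ler1n.
have a0 : 0 < a by exact: lt_le_trans a1.
have := NK d A ls A0 sp eta0 lsL lsp; set N : R := (total_points ls)%:R => NKa.
have N1 : 1 <= N by rewrite ler1n.
have NR : 0 < N by exact: lt_le_trans N1.
have size_le (t Kt : R) : 0 <= t -> 1 <= Kt -> (Lmax A c delta)%:R <= Kt * a `^ t ->
    1 + (size ls)%:R <= 2 * Kt * a `^ t.
  move=> t0 Kt1 LK.
  have at1 : 1 <= a `^ t by rewrite -(powRr0 a) ler_powR.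
  have h1 : 1 <= Kt * a `^ t by rewrite -[leLHS]mulr1 ler_pM.
  have h2 : (size ls)%:R <= Kt * a `^ t by apply: le_trans LK; rewrite ler_nat.
  by rewrite -mulrA [leRHS]mulr_natl mulr2n lerD.
rewrite ler_pdivlMr ?powR_gt0// -/a.
have [e0|e0] := leP 0 e.
  apply: (@le_trans _ _ (2 * Kb * K `^ e)); last by rewrite lerDl mulr_ge0// ltW.
  apply: (@le_trans _ _ ((2 * Kb * a `^ (beta / 2)) * a `^ (- s) * (K `^ e * a `^ ((1 + beta) * e)))).
    apply: ler_pM; rewrite ?powR_ge0//.
    - by rewrite mulr_ge0 ?powR_ge0// addr_ge0.
    - by rewrite ler_wpM2r ?powR_ge0// size_le ?LKb// ltW.
    - rewrite [a `^ (_ * e)]powRrM -powRM ?powR_ge0 ?(ltW K0)//.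
      by rewrite ge0_ler_powR ?nnegrE ?mulr_ge0 ?powR_ge0 ?(ltW K0) ?(ltW NR).
  (* The exponents balance exactly: s - (1 + beta) e = beta/2, the power of |A| that absorbs the
     factor 1 + L. *)
  have E : a `^ (beta / 2) * a `^ (- s) * a `^ ((1 + beta) * e) = 1.
    rewrite -!powRD ?(gt_eqF a0) ?implybT//.
    rewrite (_ : _ + _ = 0) ?powRr0// /s /e; field.
    by rewrite !gt_eqF// addr_gt0.
  move: E; move: (a `^ (beta / 2)) (a `^ (- s)) (a `^ ((1 + beta) * e)) (K `^ e) => x y z w E.
  have -> : 2 * Kb * x * y * (w * z) = 2 * Kb * w * (x * y * z) by ring.
  by rewrite E mulr1.
(* For e < 0 the factor N^e is at most 1, so the decay |A|^(-s) only has to absorb 1 + L. *)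
apply: (@le_trans _ _ (2 * Ks)); last by rewrite lerDr !mulr_ge0 ?powR_ge0// ltW.
have Ne : N `^ e <= 1 by rewrite -(powRr0 N) ler_powR// ltW.
apply: (@le_trans _ _ ((2 * Ks * a `^ s) * a `^ (- s) * 1)).
  apply: ler_pM; rewrite ?powR_ge0//.
  - by rewrite mulr_ge0 ?powR_ge0// addr_ge0.
  - by rewrite ler_wpM2r ?powR_ge0// size_le ?LKs// ltW.
by rewrite mulr1 -mulrA -powRD ?subrr ?powRr0 ?mulr1// (gt_eqF a0) implybT.
Qed.

(** The bound on the error is left abstract so that the estimate with explicit constant and the rate
    with epsilon are both instances. *)
Lemma lc_error_prob (R : realType) (c delta beta lambda : R) :
  1 < c -> 0 < delta < 1 -> 0 < beta < 1 -> 0 < lambda < 2 ->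
  exists2 C : R, 0 < C &
  forall (alpha : R) (d : nat) (gamma : {fset nat} -> R) (M : R),
    1 / 2 < alpha -> 1 / alpha < lambda ->
    (forall u, 0 <= gamma u) -> gamma fset0 = 1 -> 1 <= M ->
    let A : {fset 'rV[int]_d} := fset_set (@korobov_set R d alpha gamma M) in
    (2 <= #|` A|)%N -> (spread A)%:~R <= lc_eta A c ->
    forall bound : nat -> R,
    (forall N, (0 < N)%N ->
      C / (N%:R `^ (1 / (lambda * (1 + beta)) - 1 / 2)) *
        @korobov_S R d gamma alpha lambda `^ (1 / lambda) <= bound N) ->
    forall (disp : measure_display) (Omega : measurableType disp)
      (P : probability Omega R) (g : nat -> Omega -> 'rV[int]_d),
    lc_draws A c delta P g ->
    let success := [set w | exists ls : seq (lattice d),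
      [/\ lc_output A c delta g w ls,
          forall k, k \in A -> (1 <= xi A ls k)%N &
          (err_infty alpha gamma (@A_mult d A R ls) <= (bound (total_points ls))%:E)%E]] in
    measurable success /\ ((1 - delta)%:E <= P success)%E.
Proof.
move=> c1 delta01 beta01 lambda02; have [delta0 delta1] := andP delta01.
have [C C0 HC] := rate_constant c1 delta01 beta01 lambda02; exists C => //.
move=> alpha d gamma M alpha2 lambda_gt gamma0 gamma_empty M1 A A2 sp bound Hbound
  disp Omega P g draws success.
have A0 : (0 < #|` A|)%N by exact: leq_trans A2.
(* [fset_set] returns the empty set on an infinite set, so two elements already force finiteness. *)
have finA : finite_set (@korobov_set R d alpha gamma M).
  by move: A2; rewrite /A /fset_set; case: pselect => //; rewrite cardfs0.
have AE k : k \in A <-> korobov_set alpha gamma M k.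
  by rewrite /A in_fset_set// inE.
have eta0 : 0 <= lc_eta A c.
  by rewrite mulr_ge0 ?(ltW (lt_trans ltr01 c1))// subr_ge0 ler1n.
have sepA t : (0 < t)%N ->
    sep_primes A (lc_prime A c t) /\ lc_eta A c < (lc_prime A c t)%:R.
  by move=> t0; have [? ? _] := lc_primeP sp eta0 t0.
pose Q (ls : seq (lattice d)) := (forall k, k \in A -> (1 <= xi A ls k)%N) /\
  (err_infty alpha gamma (@A_mult d A R ls) <= (bound (total_points ls))%:E)%E.
have -> : success = [set w | exists ls, lc_output A c delta g w ls /\ Q ls].
  by apply/seteqP; split=> w [ls]; [move=> [? ? ?]; exists ls | move=> [? [? ?]]; exists ls].
apply: (lc_success_prob c1 sepA draws (Lmax_failure c1 delta0 delta1 A0)) => h covered_h.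
have [_ size_ls ls_prime cov] := lc_inv_run A c delta h.
set ls := (lc_run A c delta h).1 in size_ls ls_prime cov *.
have covered k : k \in A -> (1 <= xi A ls k)%N.
  move=> kA; apply: cov; move: covered_h; rewrite negbK => /fsubsetP; exact.
have ls_pos l : l \in ls -> (0 < l.1)%N.
  move=> /ls_prime[t /andP[t0 _] ->]; have [[pn _] _] := sepA t t0; exact: prime_gt0.
have N0 : (0 < total_points ls)%N.
  have /fset0Pn[k kA] : A != fset0 by rewrite -cardfs_gt0.
  have := covered k kA; rewrite /xi /total_points; case: (ls) ls_pos => [|l t] lp.
    by rewrite !big_nil.
  by move=> _; rewrite big_cons addn_gt0 lp ?mem_head.
split=> //; have [lambda0 lambda2] := andP lambda02.
apply: (le_trans (err_infty_le gamma0 gamma_empty alpha2 lambda_gt lambda2 M1 AE A0 ls_pos covered)).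
rewrite lee_fin; apply: le_trans (Hbound _ N0).
by rewrite mulrA ler_wpM2r ?powR_ge0// HC.
Qed.

(** * Limit of the rate exponent and the final statement *)

Lemma rate_exponent_cvg (R : realType) (alpha : R) : 0 < alpha ->
  (fun lb : R * R => 1 / (lb.1 * (1 + lb.2)) - 1 / 2)
    @ filter_prod ((1 / alpha)^'+) (0^'+) --> alpha - 1 / 2.
Proof.
move=> alpha0; have a0 : alpha^-1 != 0 by rewrite invr_eq0 gt_eqF.
have cvg1 : (fun lb : R * R => lb.1) @ filter_prod ((1 / alpha)^'+) (0^'+) --> 1 / alpha.
  by apply: cvg_trans cvg_fst _; exact: cvg_at_right_filter (@cvg_id _ (nbhs (1 / alpha))).
have cvg2 : (fun lb : R * R => lb.2) @ filter_prod ((1 / alpha)^'+) (0^'+) --> (0 : R).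
  by apply: cvg_trans cvg_snd _; exact: cvg_at_right_filter (@cvg_id _ (nbhs (0 : R))).
have cvg3 : (fun lb : R * R => lb.1 * (1 + lb.2))
    @ filter_prod ((1 / alpha)^'+) (0^'+) --> 1 / alpha * (1 + 0).
  by apply: cvgM => //; apply: cvgD => //; exact: cvg_cst.
have -> : alpha - 1 / 2 = (1 / alpha * (1 + 0))^-1 - 1 / 2.
  by rewrite addr0 mulr1 invf_div divr1.
under eq_fun do rewrite [1 / (_ * _)]div1r.
apply: cvgB; last exact: cvg_cst.
by apply: cvgV => //; rewrite addr0 mulr1 div1r.
Qed.

(** Since alpha > 1/2, the interval (1/alpha, 2) is nonempty, so parameters close to the limit point
    remain admissible. *)
Lemma rate_parameters (R : realType) (alpha epsilon : R) : 1 / 2 < alpha -> 0 < epsilon ->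
  exists lambda beta : R, [/\ 1 / alpha < lambda, 0 < lambda < 2, 0 < beta < 1 &
    alpha - 1 / 2 - epsilon <= 1 / (lambda * (1 + beta)) - 1 / 2].
Proof.
move=> alpha2 e0; have alpha0 : 0 < alpha by apply: lt_trans alpha2; rewrite divr_gt0.
have /cvgrPdist_le /(_ _ e0) near_e := rate_exponent_cvg alpha0.
have near_l : \forall x \near (1 / alpha)^'+, 1 / alpha < x < 2.
  near=> x; apply/andP; split; near: x; first exact: nbhs_right_gt.
  by apply: nbhs_right_lt; rewrite ltr_pdivrMr//; move: alpha2; lra.
have near_b : \forall x \near (0 : R)^'+, 0 < x < 1.
  by near=> x; apply/andP; split; near: x; [exact: nbhs_right_gt | exact: nbhs_right_lt].
have near_lb : \forall lb \near filter_prod ((1 / alpha)^'+) ((0 : R)^'+),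
    1 / alpha < lb.1 < 2 /\ 0 < lb.2 < 1.
  by exists ([set x | 1 / alpha < x < 2], [set x | 0 < x < 1]).
have [[lambda beta] [/= he [/andP[l1 l2] b01]]] := filter_ex (filterI near_e near_lb).
exists lambda, beta; split=> //.
  by rewrite l2 andbT (lt_trans _ l1)// divr_gt0.
exact: ler_distlBl he.
Unshelve. all: end_near. Qed.

(** The third conjunct makes the limiting rate quantitative: its constant is fixed before M, hence
    is uniform in N. *)
Theorem corollary4p4 (R : realType) :
  (forall c delta beta lambda : R,
    1 < c -> 0 < delta < 1 -> 0 < beta < 1 -> 0 < lambda < 2 ->
    exists2 C : R, 0 < C &
    forall (alpha : R) (d : nat) (gamma : {fset nat} -> R) (M : R),
      1 / 2 < alpha -> 1 / alpha < lambda -> (0 < d)%N ->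
      (forall u, 0 <= gamma u) -> gamma fset0 = 1 -> 1 <= M ->
      let A : {fset 'rV[int]_d} := fset_set (@korobov_set R d alpha gamma M) in
      let L : R := (Lmax A c delta)%:R in
      (2 <= #|` A|)%N ->
      Num.max (spread A)%:~R (4 * L * ln L) <= lc_eta A c ->
      forall (disp : measure_display) (Omega : measurableType disp)
        (P : probability Omega R) (g : nat -> Omega -> 'rV[int]_d),
        lc_draws A c delta P g ->
        let success := [set w | exists ls : seq (lattice d),
          [/\ lc_output A c delta g w ls,
              forall k, k \in A -> (1 <= xi A ls k)%N &
              (err_infty alpha gamma (@A_mult d A R ls) <=
               (C / ((total_points ls)%:R `^
                       (1 / (lambda * (1 + beta)) - 1 / 2)) *
                (\sum_(u : {set 'I_d})
                   gamma (labels u) `^ lambda *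
                   (2 * zeta (alpha * lambda)) ^+ #|u|) `^ (1 / lambda))%:E)%E]]
        in
        measurable success /\ ((1 - delta)%:E <= P success)%E)
  /\
  (forall alpha : R, 1 / 2 < alpha ->
    (fun lb : R * R => 1 / (lb.1 * (1 + lb.2)) - 1 / 2)
      @ filter_prod ((1 / alpha)^'+) (0^'+) --> alpha - 1 / 2)
  /\
  (forall c delta alpha epsilon : R,
    1 < c -> 0 < delta < 1 -> 1 / 2 < alpha -> 0 < epsilon ->
    forall (d : nat) (gamma : {fset nat} -> R), (0 < d)%N ->
      (forall u, 0 <= gamma u) -> gamma fset0 = 1 ->
    exists2 K : R, 0 < K &
    forall M : R, 1 <= M ->
      let A : {fset 'rV[int]_d} := fset_set (@korobov_set R d alpha gamma M) in
      let L : R := (Lmax A c delta)%:R in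
      (2 <= #|` A|)%N ->
      Num.max (spread A)%:~R (4 * L * ln L) <= lc_eta A c ->
      forall (disp : measure_display) (Omega : measurableType disp)
        (P : probability Omega R) (g : nat -> Omega -> 'rV[int]_d),
        lc_draws A c delta P g ->
        let success := [set w | exists ls : seq (lattice d),
          [/\ lc_output A c delta g w ls,
              forall k, k \in A -> (1 <= xi A ls k)%N &
              (err_infty alpha gamma (@A_mult d A R ls) <=
               (K * (total_points ls)%:R `^ (- alpha + 1 / 2 + epsilon))%:E)%E]]
        in
        measurable success /\ ((1 - delta)%:E <= P success)%E).
Proof.
split; [|split].
- move=> c delta beta lambda c1 delta01 beta01 lambda02.
  have [C C0 HC] := lc_error_prob c1 delta01 beta01 lambda02; exists C => //.
  move=> alpha d gamma M alpha2 lambda_gt _ gamma0 gamma_empty M1 A L A2.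
  rewrite ge_max => /andP[sp _] disp Omega P g draws.
  exact: (HC alpha d gamma M alpha2 lambda_gt gamma0 gamma_empty M1 A2 sp
    (fun N => C / (N%:R `^ (1 / (lambda * (1 + beta)) - 1 / 2)) *
      @korobov_S R d gamma alpha lambda `^ (1 / lambda)) _ disp Omega P g draws).
- move=> alpha alpha2; apply: rate_exponent_cvg.
  by apply: lt_trans alpha2; rewrite divr_gt0.
- move=> c delta alpha epsilon c1 delta01 alpha2 eps0 d gamma _ gamma0 gamma_empty.
  have [lambda [beta [lambda_gt lambda02 beta01 rate]]] := rate_parameters alpha2 eps0.
  have [C C0 HC] := lc_error_prob c1 delta01 beta01 lambda02.
  have S1 := @korobov_S_ge1 R d alpha lambda gamma gamma_empty alpha2 lambda_gt.
  exists (C * @korobov_S R d gamma alpha lambda `^ (1 / lambda)).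
    by rewrite mulr_gt0// powR_gt0// (lt_le_trans ltr01).
  move=> M M1 A L A2; rewrite ge_max => /andP[sp _] disp Omega P g draws.
  apply: (HC alpha d gamma M alpha2 lambda_gt gamma0 gamma_empty M1 A2 sp
    (fun N => C * @korobov_S R d gamma alpha lambda `^ (1 / lambda) *
      N%:R `^ (- alpha + 1 / 2 + epsilon)) _ disp Omega P g draws) => N N0.
  rewrite mulrAC -powRN ler_wpM2l ?mulr_ge0 ?powR_ge0 ?(ltW C0)//.
  by rewrite ler_powR ?ler1n//; move: rate; lra.
Qed.
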